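(* Let $(M,I,J,K,g)$ be a hyperhermitian manifold, let $\Omega=\omega_J+i\omega_K$, and let $P$ be the bivector field on $M$ of type $(2,0)$ with respect to $I$ given by $P(\alpha,\beta)=\Omega(\Omega^{-1}(\alpha),\Omega^{-1}(\beta))$ for $(1,0)$-forms $\alpha,\beta$ (with respect to $I$). Then $g$ is HKT if and only if $P$ is a complex Poisson structure on the complex manifold $(M,I)$.
   Context: A hypercomplex structure on $M$ is a triple $I,J,K$ of (integrable) complex structures with $IJ=-JI=K$. A hyperhermitian manifold $(M,I,J,K,g)$ is a hypercomplex manifold with a Riemannian metric $g$ that is Hermitian with respect to $I$, $J$ and $K$; put $\omega_A(X,Y)=g(AX,Y)$ for $A=I,J,K$. The form $\Omega=\omega_J+i\omega_K$ is a non-degenerate form of type $(2,0)$ with respect to $I$, and it defines an isomorphism $\Omega:T^{1,0}\to\Lambda^{1,0}$, $X\mapsto i_X\Omega$ (types with respect to $I$), with inverse $\Omega^{-1}:\Lambda^{1,0}\to T^{1,0}$. The metric $g$ is called HKT (hyperk\''ahler with torsion) if $d^c_I\omega_I=d^c_J\omega_J=d^c_K\omega_K$, where for a complex structure $A$, $d^c_A=i(\overline\partial_A-\partial_A)$ (the overall real normalization of $d^c$ is immaterial). A complex Poisson structure on a complex manifold is a smooth bivector field $P$ of type $(2,0)$ (not required to be holomorphic) with $[P,P]=0$, where $[\cdot,\cdot]$ is the Schouten bracket extended complex-linearly to complex-valued multivector fields. *)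

(* Defs.v *)
From HB Require Import structures.
From mathcomp Require Import all_boot all_order all_algebra.
From mathcomp Require Import complex.
From mathcomp Require Import all_classical all_reals all_analysis.

Set Implicit Arguments.
Unset Strict Implicit.
Unset Printing Implicit Defensive.

Import Order.TTheory GRing.Theory Num.Theory.
Import numFieldNormedType.Exports.

Local Open Scope classical_set_scope.
Local Open Scope ring_scope.

(* Conventions.  Points of R^n and tangent vectors are columns, covectors are
   rows.  Tensor fields on a manifold are given by their components in every
   chart of the atlas, as functions on R^n of which only the values on the image
   of the chart matter; the components transform by the Jacobian matrices of the
   transition maps.  The matrix A of an endomorphism acts by v |-> A *m v. *)

Section Smooth.
Variables (R : realType) (n : nat) (W : normedModType R).

(* For an open U; since the domain is finite dimensional, continuity of the
   k-th differential amounts to continuity of all iterated directional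
   derivatives. *)
Fixpoint Ck_on (k : nat) (U : set 'cV[R]_n) (f : 'cV[R]_n -> W) : Prop :=
  if k is k'.+1 then
    (forall x, U x -> differentiable f x) /\
    (forall v : 'cV[R]_n, Ck_on k' U (fun x => 'D_v f x))
  else forall x, U x -> {for x, continuous f}.

Definition smooth_on (U : set 'cV[R]_n) (f : 'cV[R]_n -> W) : Prop :=
  forall k, Ck_on k U f.
End Smooth.

Record chart (R : realType) (n : nat) (M : topologicalType) := Chart {
  dom : set M;
  img : set 'cV[R]_n;
  coord : M -> 'cV[R]_n;
  param : 'cV[R]_n -> M;
  dom_open : open dom;
  img_open : open img;
  coord_img : forall p, dom p -> img (coord p);
  param_dom : forall x, img x -> dom (param x);
  coordK : forall p, dom p -> param (coord p) = p;
  paramK : forall x, img x -> coord (param x) = x;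
  coord_continuous : {within dom, continuous coord};
  param_continuous : {within img, continuous param} }.

(* The image of dom c `&` dom c' in the coordinates c. *)
Definition overlap (R : realType) (n : nat) (M : topologicalType)
    (c c' : chart R n M) : set 'cV[R]_n :=
  img c `&` param c @^-1` dom c'.

Definition transition (R : realType) (n : nat) (M : topologicalType)
    (c c' : chart R n M) : 'cV[R]_n -> 'cV[R]_n :=
  coord c' \o param c.

(* The atlas need not be maximal. *)
Record smoothManifold (R : realType) (n : nat) := SmoothManifold {
  carrier :> topologicalType;
  carrier_hausdorff : hausdorff_space carrier;
  carrier_second_countable : @second_countable carrier;
  atlas : set (chart R n carrier);
  atlas_cover : forall p, exists2 c, atlas c & dom c p;
  atlas_compatible : forall c c', atlas c -> atlas c' ->
    smooth_on (overlap c c') (transition c c') }.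

Definition jac (R : realType) (n : nat) (f : 'cV[R]_n -> 'cV[R]_n)
    (x : 'cV[R]_n) : 'M[R]_n :=
  \matrix_(i, j) ('D_(delta_mx j 0) f x) i 0.

Section Complexification.
Variable R : realType.
Local Notation C := R[i].

Definition cplx (m n : nat) (A : 'M[R]_(m, n)) : 'M[C]_(m, n) :=
  map_mx (real_complex R) A.
Definition re_mx (m n : nat) (A : 'M[C]_(m, n)) : 'M[R]_(m, n) :=
  map_mx (@complex.Re R) A.
Definition im_mx (m n : nat) (A : 'M[C]_(m, n)) : 'M[R]_(m, n) :=
  map_mx (@complex.Im R) A.
Definition ii : C := ('i)%C.

Definition csmooth_on (n m p : nat) (U : set 'cV[R]_n)
    (f : 'cV[R]_n -> 'M[C]_(m, p)) : Prop :=
  smooth_on U (fun x => re_mx (f x)) /\ smooth_on U (fun x => im_mx (f x)).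

(* Directional derivative of a complex valued function along a complex tangent
   vector, complex linear in both. *)
Definition cderive_real (n : nat) (v : 'cV[R]_n) (f : 'cV[R]_n -> C)
    (x : 'cV[R]_n) : C :=
  real_complex R ('D_v (fun y => complex.Re (f y)) x)
  + ii * real_complex R ('D_v (fun y => complex.Im (f y)) x).
Definition cderive (n : nat) (w : 'cV[C]_n) (f : 'cV[R]_n -> C)
    (x : 'cV[R]_n) : C :=
  cderive_real (re_mx w) f x + ii * cderive_real (im_mx w) f x.

(* Projections of the complexified tangent space onto T^{1,0} and T^{0,1}. *)
Definition pi10 (n : nat) (A : 'M[R]_n) : 'M[C]_n :=
  2^-1 *: (1%:M - ii *: cplx A).
Definition pi01 (n : nat) (A : 'M[R]_n) : 'M[C]_n :=
  2^-1 *: (1%:M + ii *: cplx A).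

Definition vec10 (n : nat) (A : 'M[R]_n) (Z : 'cV[C]_n) : Prop :=
  cplx A *m Z = ii *: Z.
Definition covec01 (n : nat) (A : 'M[R]_n) (a : 'rV[C]_n) : Prop :=
  a *m cplx A = - ii *: a.
End Complexification.

(* Complex differential forms on (an open subset of) R^n. *)
Section Forms.
Variables (R : realType) (n : nat).
Local Notation C := R[i].

Definition form (k : nat) := 'cV[R]_n -> ('I_k -> 'cV[C]_n) -> C.

(* The arguments v_i are constant vector fields, so no bracket terms occur. *)
Definition ext_d (k : nat) (w : form k) : form k.+1 := fun x v =>
  \sum_(j < k.+1)
    (-1) ^+ j * cderive (v j) (fun y => w y (fun i => v (lift j i))) x.

Variable A : 'cV[R]_n -> 'M[R]_n.

(* The component of type (p, k - p) of a k-form with respect to A. *)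
Definition type_comp (k p : nat) (w : form k) : form k := fun x v =>
  \sum_(S : {set 'I_k} | #|S| == p)
    w x (fun i => (if i \in S then pi10 (A x) else pi01 (A x)) *m v i).

Definition del (k : nat) (w : form k) : form k.+1 := fun x v =>
  \sum_(p < k.+1) type_comp p.+1 (ext_d (type_comp p w)) x v.
Definition delbar (k : nat) (w : form k) : form k.+1 := fun x v =>
  \sum_(p < k.+1) type_comp p (ext_d (type_comp p w)) x v.
Definition dc (k : nat) (w : form k) : form k.+1 := fun x v =>
  ii R * (delbar w x v - del w x v).
End Forms.

Section Structures.
Variables (R : realType) (n : nat) (M : smoothManifold R n).
Local Notation C := R[i].

(* Components, in each chart, of a tensor field with two indices. *)
Definition mx_field := chart R n M -> 'cV[R]_n -> 'M[R]_n.
Definition cmx_field := chart R n M -> 'cV[R]_n -> 'M[C]_n.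

Definition smooth_mx_field (T : mx_field) : Prop :=
  forall c, atlas c -> smooth_on (img c) (T c).

Definition is_endo_field (A : mx_field) : Prop :=
  smooth_mx_field A /\
  forall c c' x, atlas c -> atlas c' -> overlap c c' x ->
    let t := transition c c' in
    A c' (t x) *m jac t x = jac t x *m A c x.

Definition is_riemannian_metric (g : mx_field) : Prop :=
  [/\ smooth_mx_field g,
      forall c c' x, atlas c -> atlas c' -> overlap c c' x ->
        let t := transition c c' in
        g c x = (jac t x)^T *m g c' (t x) *m jac t x,
      forall c x, atlas c -> img c x -> (g c x)^T = g c x &
      forall c x (v : 'cV[R]_n), atlas c -> img c x -> v != 0 ->
        0 < (v^T *m g c x *m v) 0 0].

Definition lie_bracket (X Y : 'cV[R]_n -> 'cV[R]_n) : 'cV[R]_n -> 'cV[R]_n :=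
  fun x => 'D_(X x) Y x - 'D_(Y x) X x.

Definition nijenhuis (A : 'cV[R]_n -> 'M[R]_n) (X Y : 'cV[R]_n -> 'cV[R]_n) :
    'cV[R]_n -> 'cV[R]_n := fun x =>
  let AX := fun y => A y *m X y in
  let AY := fun y => A y *m Y y in
  lie_bracket AX AY x - A x *m lie_bracket AX Y x - A x *m lie_bracket X AY x
  - lie_bracket X Y x.

Definition is_complex_structure (A : mx_field) : Prop :=
  [/\ is_endo_field A,
      forall c x, atlas c -> img c x -> A c x *m A c x = - 1%:M &
      forall c (X Y : 'cV[R]_n -> 'cV[R]_n) x, atlas c ->
        smooth_on (img c) X -> smooth_on (img c) Y -> img c x ->
        nijenhuis (A c) X Y x = 0].

Definition is_hypercomplex (I J K : mx_field) : Prop :=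
  [/\ is_complex_structure I, is_complex_structure J, is_complex_structure K &
      forall c x, atlas c -> img c x ->
        I c x *m J c x = K c x /\ - (J c x *m I c x) = K c x].

Definition is_hermitian (A g : mx_field) : Prop :=
  forall c x, atlas c -> img c x -> (A c x)^T *m g c x *m A c x = g c x.

Definition is_hyperhermitian (I J K g : mx_field) : Prop :=
  is_hypercomplex I J K /\ is_riemannian_metric g /\
  [/\ is_hermitian I g, is_hermitian J g & is_hermitian K g].

(* The Gram matrix of omega_A(X, Y) = g(A X, Y). *)
Definition omega_mx (A g : mx_field) : mx_field := fun c x =>
  (A c x)^T *m g c x.

Definition omega (A g : mx_field) (c : chart R n M) : form R n 2 := fun x v =>
  ((v 0)^T *m cplx (omega_mx A g c x) *m v 1) 0 0.

Definition HKT (I J K g : mx_field) : Prop :=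
  forall c x (v : 'I_3 -> 'cV[C]_n), atlas c -> img c x ->
    dc (I c) (omega I g c) x v = dc (J c) (omega J g c) x v /\
    dc (J c) (omega J g c) x v = dc (K c) (omega K g c) x v.

Definition Omega_mx (J K g : mx_field) : cmx_field := fun c x =>
  cplx (omega_mx J g c x) + ii R *: cplx (omega_mx K g c x).

Definition Omega (J K g : mx_field) c x (Z W : 'cV[C]_n) : C :=
  (Z^T *m Omega_mx J K g c x *m W) 0 0.

(* The interior product i_Z Omega. *)
Definition iOmega (J K g : mx_field) c x (Z : 'cV[C]_n) : 'rV[C]_n :=
  Z^T *m Omega_mx J K g c x.

(* The vector Z in T^{1,0} such that i_Z Omega = a, for a in Lambda^{1,0}. *)
Definition Omega_inv (I J K g : mx_field) c x (a : 'rV[C]_n) : 'cV[C]_n :=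
  xget 0 [set Z | vec10 (I c x) Z /\ iOmega J K g c x Z = a].

(* P^{ij} = P(dx^i, dx^j); being of type (2, 0), P only depends on the (1, 0)
   parts of its arguments, and a *m pi10 (I c x) is the (1, 0) part of a. *)
Definition P_of (I J K g : mx_field) : cmx_field := fun c x =>
  \matrix_(i, j)
    Omega J K g c x
      (Omega_inv I J K g c x (delta_mx 0 i *m pi10 (I c x)))
      (Omega_inv I J K g c x (delta_mx 0 j *m pi10 (I c x))).

Definition is_bivector_field (P : cmx_field) : Prop :=
  [/\ forall c, atlas c -> csmooth_on (img c) (P c),
      forall c c' x, atlas c -> atlas c' -> overlap c c' x ->
        let t := transition c c' in
        P c' (t x) = cplx (jac t x) *m P c x *m (cplx (jac t x))^T &
      forall c x, atlas c -> img c x -> (P c x)^T = - P c x].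

Definition is_type20 (I : mx_field) (P : cmx_field) : Prop :=
  forall c x (a : 'rV[C]_n), atlas c -> img c x ->
    covec01 (I c x) a -> a *m P c x = 0.

(* The Schouten bracket of two bivector fields on an open subset of R^n, on
   constant covectors a, b, e: the cyclic sum over (a, b, e) of
   (P(a, -) . Q(b, e) + Q(a, -) . P(b, e)), that is, in components,
   [P, Q]^{ijk} = P^{il} d_l Q^{jk} + Q^{il} d_l P^{jk} + cyclic.  It satisfies
   [X1 /\ X2, Y1 /\ Y2] = \sum_(i, j) (-1)^(i+j) [X_i, Y_j] /\ X_{3-i} /\ Y_{3-j}. *)
Definition schouten (P Q : 'cV[R]_n -> 'M[C]_n) (x : 'cV[R]_n)
    (a b e : 'rV[C]_n) : C :=
  let ev (T : 'cV[R]_n -> 'M[C]_n) (u v : 'rV[C]_n) :=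
    fun y : 'cV[R]_n => (u *m T y *m v^T) 0 0 in
  let term u v w :=
    cderive (u *m P x)^T (ev Q v w) x + cderive (u *m Q x)^T (ev P v w) x in
  term a b e + term b e a + term e a b.

Definition is_complex_poisson (I : mx_field) (P : cmx_field) : Prop :=
  [/\ is_bivector_field P, is_type20 I P &
      forall c x a b e, atlas c -> img c x -> schouten (P c) (P c) x a b e = 0].

End Structures.

(* Main.v *)
From HB Require Import structures.
From mathcomp Require Import all_boot all_order all_algebra.
From mathcomp Require Import ring.

(** Work in a chart, with complexified 1-jets at a point.  For a Hermitian
    complex structure A put T_A(X, Y, Z) = dw_A(AX, AY, AZ), w_A = g(A., .).
    Integrability of A makes dw_A of type (2, 1) + (1, 2), so that
    d^c_A w_A = - T_A and HKT means T_I = T_J = T_K.  The Levi-Civita derivative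
    of A is a combination of values of T_A, which says that the metric connection
    of skew torsion T_A preserves A; hence T_J = T_K already forces T_I = T_J.
    Comparing types with respect to I, T_J = T_K iff the (3, 0) part of
    dOmega vanishes.  Finally P = - 1/4 (J - iK) g^-1 satisfies
    P Omega = - pi^{1,0}; differentiating this gives, again by integrability of I,
    [P, P](a, b, e) = - 2 dOmega(aP, bP, eP), where aP ranges over T^{1,0}. *)

Set Implicit Arguments.
Unset Strict Implicit.
Unset Printing Implicit Defensive.
Import GRing.Theory.
Local Open Scope ring_scope.

(** * Algebra of the 1-jet of a Hermitian structure *)

(** Two obstacles shape the computation. First, Omega kills T^{0,1}, so P inverts -Omega only up to
    the projection onto T^{1,0}. The formula for the derivative of an inverse then acquires terms in
    the derivative of that projection, that is, of I. Integrability of I makes them symmetric on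
    T^{1,0}, and they cancel in the cyclic sum. Second, [P, P] sees only the (3, 0) part of dOmega,
    whereas T_J - T_K has eight components with respect to I. On eigenvectors of I the vectors JX
    and KX are proportional, so each component is one of dOmega or of its conjugate. The six mixed
    ones are of type (1, 2) for dOmega or (2, 1) for the conjugate, and vanish by integrability of
    I; the (0, 3) part of the conjugate is controlled because the tensors are real. The constants in
    P: J + iK is 2J on T^{1,0}, so Omega^{-1} sends a to -1/2 J g^-1 a^T; and J - iK acts as 2J from
    the right on (1, 0)-covectors, which turns a J into a (J - iK) / 2 and yields the factor 1/4. *)

(* q X Y Z stands for g((D_X A) Y, Z), c X for the derivative of g along X, w X for
   that of the 2-form g(A Y, Z), and q_N is the vanishing of the Nijenhuis tensor. *)
Section AlmostHermitianJet.
Variables (F : fieldType) (V : lmodType F) (A : V -> V) (q c : V -> V -> V -> F).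
Let w X Y Z := q X Y Z + c X (A Y) Z.
Let dw X Y Z := w X Y Z + w Y Z X + w Z X Y.
Hypothesis AA : forall X, A (A X) = - X.
Hypothesis qN : forall X Y Z,
  [/\ q (- X) Y Z = - q X Y Z, q X (- Y) Z = - q X Y Z & q X Y (- Z) = - q X Y Z].
Hypothesis cN : forall X Y Z,
  [/\ c (- X) Y Z = - c X Y Z, c X (- Y) Z = - c X Y Z & c X Y (- Z) = - c X Y Z].
Hypothesis c_sym : forall X Y Z, c X Y Z = c X Z Y.
Hypothesis q_A : forall X Y Z, q X (A Y) Z = q X Y (A Z).
Hypothesis w_alt : forall X Y Z, w X Y Z = - w X Z Y.
Hypothesis q_N : forall X Y Z,
  q (A X) Y Z + q X Y (A Z) = q (A Y) X Z + q Y X (A Z).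

Let sk X Y Z := w X Y Z + w X Z Y.
Let nn X Y Z := q (A X) Y Z + q X Y (A Z) - (q (A Y) X Z + q Y X (A Z)).

Let sk0 X Y Z : sk X Y Z = 0. Proof. by rewrite /sk w_alt addNr. Qed.
Let nn0 X Y Z : nn X Y Z = 0. Proof. by rewrite /nn q_N subrr. Qed.
Let q1N X Y Z : q (- X) Y Z = - q X Y Z. Proof. by case: (qN X Y Z). Qed.
Let q2N X Y Z : q X (- Y) Z = - q X Y Z. Proof. by case: (qN X Y Z). Qed.
Let q3N X Y Z : q X Y (- Z) = - q X Y Z. Proof. by case: (qN X Y Z). Qed.
Let c1N X Y Z : c (- X) Y Z = - c X Y Z. Proof. by case: (cN X Y Z). Qed.
Let c2N X Y Z : c X (- Y) Z = - c X Y Z. Proof. by case: (cN X Y Z). Qed.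
Let c3N X Y Z : c X Y (- Z) = - c X Y Z. Proof. by case: (cN X Y Z). Qed.
Let cE X Y Z :=
  (fun W => c_sym W Z Y, fun W => c_sym W (A Z) Y,
   fun W => c_sym W Z (A Y), fun W => c_sym W (A Z) (A Y),
   fun W => c_sym W Z X, fun W => c_sym W (A Z) X,
   fun W => c_sym W Z (A X), fun W => c_sym W (A Z) (A X),
   fun W => c_sym W Y X, fun W => c_sym W (A Y) X,
   fun W => c_sym W Y (A X), fun W => c_sym W (A Y) (A X)).

(* That is, dw has no component of type (3, 0) or (0, 3).  The combination of
   instances of w_alt and q_N, here and below, comes from solving a linear system. *)
Lemma dw_type X Y Z :
  dw X Y Z = dw (A X) (A Y) Z + dw (A X) Y (A Z) + dw X (A Y) (A Z).
Proof.
suff E : dw X Y Z - (dw (A X) (A Y) Z + dw (A X) Y (A Z) + dw X (A Y) (A Z)) =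
    - sk X (A Y) (A Z) - sk (A Z) (A X) Y - sk (A X) (A Y) Z - sk (A Y) (A X) Z
    + sk Z X Y + sk Y X Z + nn X (A Z) Y - nn (A X) Y Z - nn Y (A Z) X.
  by apply: subr0_eq; rewrite E !sk0 !nn0; ring.
rewrite /dw /sk /nn /w !(q_A, AA, q1N, q2N, q3N, c1N, c2N, c3N).
rewrite !(cE X Y Z).
ring.
Qed.

(* Twice the first Christoffel symbols of a metric of derivative [c]. *)
Let lc X Y Z := c X Y Z + c Y X Z - c Z X Y.

(* The left hand side is 2 g((nabla_X A) Y, Z), for the Levi-Civita connection. *)
Lemma nablaA_dw X Y Z :
  2 * q X Y Z + lc X (A Y) Z + lc X Y (A Z) = dw (A X) Y (A Z) + dw (A X) (A Y) Z.
Proof.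
suff E : 2 * q X Y Z + lc X (A Y) Z + lc X Y (A Z)
    - (dw (A X) Y (A Z) + dw (A X) (A Y) Z) =
    sk X Y Z - sk (A X) (A Y) Z - sk (A Y) (A X) Z - sk Y (A X) (A Z)
    + nn (A X) Z Y - nn (A X) Y Z.
  by apply: subr0_eq; rewrite E !sk0 !nn0; ring.
rewrite /lc /dw /sk /nn /w !(q_A, AA, q1N, q2N, q3N, c1N, c2N, c3N).
rewrite !(cE X Y Z).
ring.
Qed.
End AlmostHermitianJet.

(** * Trilinear forms and their types with respect to a complex structure *)

Section Trilinear.
Variables (F : fieldType) (V : lmodType F).
Implicit Types (t : V -> V -> V -> F) (X Y Z : V).

Definition trilinear t := forall a X X' Y Z,
  [/\ t (a *: X + X') Y Z = a * t X Y Z + t X' Y Z,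
      t Y (a *: X + X') Z = a * t Y X Z + t Y X' Z &
      t Y Z (a *: X + X') = a * t Y Z X + t Y Z X'].

Lemma trilinear_comb t : trilinear t ->
  (forall a b X X' Y Z, t (a *: (X + b *: X')) Y Z = a * (t X Y Z + b * t X' Y Z))
  * (forall a b X X' Y Z, t Y (a *: (X + b *: X')) Z = a * (t Y X Z + b * t Y X' Z))
  * (forall a b X X' Y Z, t Y Z (a *: (X + b *: X')) = a * (t Y Z X + b * t Y Z X')).
Proof.
move=> tl.
have t0 Y Z : [/\ t 0 Y Z = 0, t Y 0 Z = 0 & t Y Z 0 = 0].
  by have [] := tl (-1) 0 0 Y Z; rewrite scaler0 addr0 !mulN1r !addNr.
have tE a b X X' Y Z :
  [/\ t (a *: (X + b *: X')) Y Z = a * (t X Y Z + b * t X' Y Z),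
      t Y (a *: (X + b *: X')) Z = a * (t Y X Z + b * t Y X' Z) &
      t Y Z (a *: (X + b *: X')) = a * (t Y Z X + b * t Y Z X')].
  have [t1 t2 t3] := t0 Y Z.
  rewrite -[a *: _]addr0 [X + _]addrC.
  have [-> -> ->] := tl a (b *: X' + X) 0 Y Z; have [-> -> ->] := tl b X' X Y Z.
  by rewrite t1 t2 t3 !addr0; split; congr (_ * _); rewrite addrC.
by split=> [|a b X X' Y Z]; [split=> a b X X' Y Z|]; have [] := tE a b X X' Y Z.
Qed.

Lemma trilinearZ t a X Y Z : trilinear t ->
  [/\ t (a *: X) Y Z = a * t X Y Z, t Y (a *: X) Z = a * t Y X Z &
      t Y Z (a *: X) = a * t Y Z X].
Proof.
move=> /trilinear_comb[[/(_ a 0 X 0) e1 /(_ a 0 X 0) e2] /(_ a 0 X 0) e3].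
by move: (e1 Y Z) (e2 Y Z) (e3 Y Z); rewrite scale0r addr0 !mul0r !addr0.
Qed.

Lemma trilinearN t X Y Z : trilinear t ->
  [/\ t (- X) Y Z = - t X Y Z, t Y (- X) Z = - t Y X Z & t Y Z (- X) = - t Y Z X].
Proof.
by move=> tl; have := trilinearZ (-1) X Y Z tl; rewrite scaleN1r !mulN1r.
Qed.

Lemma trilinearB t t' : trilinear t -> trilinear t' ->
  trilinear (fun X Y Z => t X Y Z - t' X Y Z).
Proof.
move=> tl tl' a X X' Y Z; have [-> -> ->] := tl a X X' Y Z.
by have [-> -> ->] := tl' a X X' Y Z; split; ring.
Qed.

(** Carrying [A] once around the three slots changes the sign three times, so [t (A X) Y Z] equals
    its own opposite. Applied to the difference of two torsions, this is the uniqueness of the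
    metric connection with skew torsion preserving a complex structure. *)
Lemma cyclic_skew_eq0 (A : V -> V) t : 2 != 0 :> F ->
  (forall X Y Z, t X Y Z = t Y Z X) ->
  (forall X Y Z, t X (A Y) Z = - t X Y (A Z)) -> forall X Y Z, t (A X) Y Z = 0.
Proof.
move=> two_neq0 tC tA X Y Z.
have t13 U V' W : t (A U) V' W = - t U V' (A W).
  by rewrite (tC (A U)) (tC U V') (tA V' W U) opprK.
have t12 : t X (A Y) Z = - t (A X) Y Z by rewrite (tC X) (t13 Y Z X) (tC (A X)).
have /eqP : t (A X) Y Z + t (A X) Y Z = 0 by rewrite {2}t13 -tA t12 subrr.
by rewrite -mulr2n -mulr_natl mulf_eq0 (negbTE two_neq0) => /eqP.
Qed.

Variables (A : {linear V -> V}) (s : F).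
Hypotheses (two_neq0 : 2 != 0 :> F) (ss : s * s = -1).
Hypothesis AA : forall X, A (A X) = - X.

(* [s] being a square root of -1, these are the projections onto the
   eigenspaces of A for the eigenvalues s and -s. *)
Let p10 X := 2^-1 *: (X + (- s) *: A X).
Let p01 X := 2^-1 *: (X + s *: A X).

(** By the hypothesis on types, [t] is the sum of a (2, 1) part and a (1, 2) part. Inserting [A] in
    all three slots multiplies them by s * s * (- s) = s and by - s respectively, which is the
    opposite of the left hand side. For s = i and t = d omega this computes d^c omega. *)
Lemma trilinear_types t : trilinear t ->
  (forall X Y Z, t X Y Z = t (A X) (A Y) Z + t (A X) Y (A Z) + t X (A Y) (A Z)) ->
  forall X Y Z,
  s * ((t (p10 X) (p01 Y) (p01 Z) + t (p01 X) (p10 Y) (p01 Z)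
        + t (p01 X) (p01 Y) (p10 Z))
     - (t (p01 X) (p10 Y) (p10 Z) + t (p10 X) (p01 Y) (p10 Z)
        + t (p10 X) (p10 Y) (p01 Z))) = - t (A X) (A Y) (A Z).
Proof.
move=> tl typ X Y Z.
have := typ (A X) (A Y) (A Z); rewrite !AA.
have tN U W W' := trilinearN U W W' tl.
have [-> _ _] := tN X (- Y) (A Z); have [_ -> _] := tN Y X (A Z).
have [-> _ _] := tN X (A Y) (- Z); have [_ _ ->] := tN Z X (A Y).
have [_ -> _] := tN Y (A X) (- Z); have [_ _ ->] := tN Z (A X) Y.
rewrite !opprK => tAAA.
have four_neq0 : 4 != 0 :> F.
  by rewrite -[4%N]/(2 * 2)%N natrM mulf_neq0.
rewrite /p10 /p01 !(trilinear_comb tl).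
(* In the difference of the two triples the terms with an even number of [A] cancel. Those with a
   single [A] are then collapsed by [tAAA] into the term with three. *)
transitivity ((s * s * (t (A X) Y Z + t X (A Y) Z + t X Y (A Z))
  - 3 * (s * s) ^+ 2 * t (A X) (A Y) (A Z)) / 4).
  by field; rewrite four_neq0 ?two_neq0.
by rewrite ss tAAA; field; rewrite four_neq0 ?two_neq0.
Qed.

Lemma trilinear_eigen0 t : trilinear t ->
  (forall a b c X Y Z, a = s \/ a = - s -> b = s \/ b = - s -> c = s \/ c = - s ->
     A X = a *: X -> A Y = b *: Y -> A Z = c *: Z -> t X Y Z = 0) ->
  forall X Y Z, t X Y Z = 0.
Proof.
move=> tl eig X Y Z.
have dec U : U = 1 *: p10 U + p01 U.
  rewrite scale1r -scalerDr addrACA -scalerDl addNr scale0r addr0 -mulr2n.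
  by rewrite -scaler_nat scalerA mulVf ?scale1r.
have A10 U : A (p10 U) = s *: p10 U.
  rewrite /p10 linearZ linearD linearZ AA /= scalerN !scaleNr opprK.
  rewrite [RHS]scalerA [s * _]mulrC -[RHS]scalerA; congr (_ *: _).
  rewrite scalerBr scalerA ss.
  by rewrite scaleN1r opprK [in RHS]addrC.
have A01 U : A (p01 U) = (- s) *: p01 U.
  rewrite /p01 linearZ linearD linearZ AA /= scalerN.
  rewrite [RHS]scalerA [- s * _]mulrC -[RHS]scalerA; congr (_ *: _).
  rewrite scalerDr scalerA mulNr ss.
  by rewrite opprK scale1r scaleNr [in RHS]addrC.
have l : s = s \/ s = - s by left.
have r : - s = s \/ - s = - s by right.
have s1 U Y' Z' : t (p10 U) Y' Z' = 0 -> t (p01 U) Y' Z' = 0 -> t U Y' Z' = 0.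
  move=> h1 h2; rewrite (dec U).
  have [-> _ _] := tl 1 (p10 U) (p01 U) Y' Z'.
  by rewrite h1 h2 mulr0 addr0.
have s2 U Y' Z' : t Y' (p10 U) Z' = 0 -> t Y' (p01 U) Z' = 0 -> t Y' U Z' = 0.
  move=> h1 h2; rewrite (dec U).
  have [_ -> _] := tl 1 (p10 U) (p01 U) Y' Z'.
  by rewrite h1 h2 mulr0 addr0.
have s3 U Y' Z' : t Y' Z' (p10 U) = 0 -> t Y' Z' (p01 U) = 0 -> t Y' Z' U = 0.
  move=> h1 h2; rewrite (dec U).
  have [_ _ ->] := tl 1 (p10 U) (p01 U) Y' Z'.
  by rewrite h1 h2 mulr0 addr0.
apply: s1; apply: s2; apply: s3.
- exact: (eig _ _ _ _ _ _ l l l (A10 X) (A10 Y) (A10 Z)).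
- exact: (eig _ _ _ _ _ _ l l r (A10 X) (A10 Y) (A01 Z)).
- exact: (eig _ _ _ _ _ _ l r l (A10 X) (A01 Y) (A10 Z)).
- exact: (eig _ _ _ _ _ _ l r r (A10 X) (A01 Y) (A01 Z)).
- exact: (eig _ _ _ _ _ _ r l l (A01 X) (A10 Y) (A10 Z)).
- exact: (eig _ _ _ _ _ _ r l r (A01 X) (A10 Y) (A01 Z)).
- exact: (eig _ _ _ _ _ _ r r l (A01 X) (A01 Y) (A10 Z)).
- exact: (eig _ _ _ _ _ _ r r r (A01 X) (A01 Y) (A01 Z)).
Qed.
End Trilinear.

(** * Matrix 1-jets of Hermitian complex structures *)

Section HermitianJets.
Variables (F : fieldType) (n : nat).
Implicit Types (B A g : 'M[F]_n) (D dA dg : {linear 'cV[F]_n -> 'M[F]_n}).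
Implicit Types X Y Z : 'cV[F]_n.

Definition bil B X Y : F := (X^T *m B *m Y) 0 0.

Lemma bilPl B a X X' Y : bil B (a *: X + X') Y = a * bil B X Y + bil B X' Y.
Proof. by rewrite /bil linearP !mulmxDl -!scalemxAl !mxE. Qed.

Lemma bilPr B a X Y Y' : bil B X (a *: Y + Y') = a * bil B X Y + bil B X Y'.
Proof. by rewrite /bil mulmxDr -!scalemxAr !mxE. Qed.

Lemma bilP a B B' X Y : bil (a *: B + B') X Y = a * bil B X Y + bil B' X Y.
Proof. by rewrite /bil mulmxDr mulmxDl -scalemxAr -scalemxAl !mxE. Qed.

Lemma bilDl B X X' Y : bil B (X + X') Y = bil B X Y + bil B X' Y.
Proof. by have := bilPl B 1 X X' Y; rewrite scale1r mul1r. Qed.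

Lemma bilDr B X Y Y' : bil B X (Y + Y') = bil B X Y + bil B X Y'.
Proof. by have := bilPr B 1 X Y Y'; rewrite scale1r mul1r. Qed.

Lemma bilD B B' X Y : bil (B + B') X Y = bil B X Y + bil B' X Y.
Proof. by have := bilP 1 B B' X Y; rewrite scale1r mul1r. Qed.

Lemma bilZ a B X Y : bil (a *: B) X Y = a * bil B X Y.
Proof. by rewrite /bil -scalemxAr -scalemxAl mxE. Qed.

Lemma bilZl a B X Y : bil B (a *: X) Y = a * bil B X Y.
Proof. by rewrite /bil linearZ /= -!scalemxAl mxE. Qed.

Lemma bilZr a B X Y : bil B X (a *: Y) = a * bil B X Y.
Proof. by rewrite /bil -scalemxAr mxE. Qed.

Lemma bilNl B X Y : bil B (- X) Y = - bil B X Y.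
Proof. by rewrite /bil linearN !mulNmx mxE. Qed.

Lemma bilNr B X Y : bil B X (- Y) = - bil B X Y.
Proof. by rewrite /bil !mulmxN mxE. Qed.

Lemma bilN B X Y : bil (- B) X Y = - bil B X Y.
Proof. by rewrite /bil mulmxN mulNmx mxE. Qed.

Lemma bil_mulr B A X Y : bil (B *m A) X Y = bil B X (A *m Y).
Proof. by rewrite /bil !mulmxA. Qed.

Lemma bil_mull B A X Y : bil (A^T *m B) X Y = bil B (A *m X) Y.
Proof. by rewrite /bil trmx_mul !mulmxA. Qed.

Lemma bil_tr B X Y : bil B^T X Y = bil B Y X.
Proof.
by rewrite /bil -[Y^T *m B *m X]trmxK [in RHS]mxE !trmx_mul trmxK mulmxA.
Qed.

Definition bilE := (bilDl, bilDr, bilD, bilNl, bilNr, bilN).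

(* The exterior derivative, on constant vector fields, of a 2-form whose
   Gram matrix has derivative [dB]. *)
Definition cyc3 (dB : 'cV[F]_n -> 'M[F]_n) X Y Z : F :=
  bil (dB X) Y Z + bil (dB Y) Z X + bil (dB Z) X Y.

Lemma cyc3C dB X Y Z : cyc3 dB X Y Z = cyc3 dB Y Z X.
Proof. by rewrite /cyc3 -addrA [LHS]addrC. Qed.

Lemma cyc3DZ a dB dB' X Y Z :
  cyc3 (fun U => dB U + a *: dB' U) X Y Z = cyc3 dB X Y Z + a * cyc3 dB' X Y Z.
Proof. by rewrite /cyc3 !bilD !bilZ; ring. Qed.

Lemma cyc3_trilinear dB : linear dB -> trilinear (cyc3 dB).
Proof.
by move=> dBP a X X' Y Z; rewrite /cyc3 !dBP !bilP !bilPl !bilPr; split; ring.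
Qed.

(* The derivative of the Gram matrix A^T g of omega_A. *)
Definition d_omega A g dA dg X := (dA X)^T *m g + A^T *m dg X.

Lemma d_omega_linear A g dA dg : linear (d_omega A g dA dg).
Proof.
move=> a X Y; rewrite /d_omega !linearP /= mulmxDl -scalemxAl.
by rewrite scalerDr addrACA.
Qed.

(** The pointwise identities of an integrable Hermitian structure together with their first
    derivatives. [hj_nijenhuis] is the Nijenhuis tensor on constant vector fields, where every Lie
    bracket reduces to a derivative of [A]; as the tensor is pointwise, nothing is lost. *)
Record hermitian_jet A g dA dg : Prop := HermitianJet {
  hj_sq : A *m A = - 1%:M;
  hj_sym : g^T = g;
  hj_herm : A^T *m g = - (g *m A);
  hj_dsq : forall X, dA X *m A = - (A *m dA X);
  hj_dsym : forall X, (dg X)^T = dg X;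
  hj_dherm : forall X, d_omega A g dA dg X = - (dg X *m A + g *m dA X);
  hj_nijenhuis : forall X Y, dA (A *m X) *m Y - dA (A *m Y) *m X
    + A *m (dA Y *m X) - A *m (dA X *m Y) = 0 }.

Lemma d_omega_alt A g dA dg : hermitian_jet A g dA dg ->
  forall X, (d_omega A g dA dg X)^T = - d_omega A g dA dg X.
Proof.
move=> h X; rewrite [in RHS](hj_dherm h) opprK /d_omega linearD /= !trmx_mul.
by rewrite !trmxK (hj_sym h) (hj_dsym h) addrC.
Qed.

Section OneJet.
Variables (A g : 'M[F]_n) (dA dg : {linear 'cV[F]_n -> 'M[F]_n}).
Hypothesis h : hermitian_jet A g dA dg.
Let q X Y Z := bil g (dA X *m Y) Z.
Let c X Y Z := bil (dg X) Y Z.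
Let dw := cyc3 (d_omega A g dA dg).

Lemma hj_AA X : A *m (A *m X) = - X.
Proof. by rewrite mulmxA (hj_sq h) mulNmx mul1mx. Qed.

Lemma hj_bil_A X Y : bil g (A *m X) Y = - bil g X (A *m Y).
Proof. by rewrite -bil_mull (hj_herm h) bilN bil_mulr. Qed.

Let wE X Y Z : bil (d_omega A g dA dg X) Y Z = q X Y Z + c X (A *m Y) Z.
Proof. by rewrite /d_omega bilD !bil_mull. Qed.

Let qN X Y Z :
  [/\ q (- X) Y Z = - q X Y Z, q X (- Y) Z = - q X Y Z & q X Y (- Z) = - q X Y Z].
Proof. by rewrite /q linearN mulNmx mulmxN bilNl bilNr. Qed.

Let cN X Y Z :
  [/\ c (- X) Y Z = - c X Y Z, c X (- Y) Z = - c X Y Z & c X Y (- Z) = - c X Y Z].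
Proof. by rewrite /c linearN bilN bilNl bilNr. Qed.

Let c_sym X Y Z : c X Y Z = c X Z Y.
Proof. by rewrite /c -bil_tr (hj_dsym h). Qed.

Let q_A X Y Z : q X (A *m Y) Z = q X Y (A *m Z).
Proof. by rewrite /q mulmxA (hj_dsq h) mulNmx -mulmxA bilNl hj_bil_A opprK. Qed.

Let w_alt X Y Z :
  q X Y Z + c X (A *m Y) Z = - (q X Z Y + c X (A *m Z) Y).
Proof. by rewrite -!wE -bil_tr (d_omega_alt h) bilN. Qed.

Let q_N X Y Z :
  q (A *m X) Y Z + q X Y (A *m Z) = q (A *m Y) X Z + q Y X (A *m Z).
Proof.
have := congr1 (fun U => bil g U Z) (hj_nijenhuis h X Y).
rewrite !bilE !hj_bil_A [bil _ 0 _]/bil trmx0 !mul0mx mxE !opprK => E.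
by apply: subr0_eq; rewrite -{}E /q; ring.
Qed.

Lemma hj_type X Y Z : dw X Y Z = dw (A *m X) (A *m Y) Z + dw (A *m X) Y (A *m Z)
  + dw X (A *m Y) (A *m Z).
Proof. by rewrite /dw /cyc3 !wE (dw_type hj_AA qN cN c_sym q_A w_alt q_N). Qed.

Lemma hj_nabla X Y Z :
  2 * q X Y Z + (c X (A *m Y) Z + c (A *m Y) X Z - c Z X (A *m Y))
    + (c X Y (A *m Z) + c Y X (A *m Z) - c (A *m Z) X Y)
  = dw (A *m X) Y (A *m Z) + dw (A *m X) (A *m Y) Z.
Proof. by rewrite /dw /cyc3 !wE (nablaA_dw hj_AA qN cN c_sym q_A w_alt q_N). Qed.

Definition torsion X Y Z := dw (A *m X) (A *m Y) (A *m Z).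

Lemma torsion_trilinear : trilinear torsion.
Proof.
move=> a X X' Y Z; rewrite /torsion !mulmxDr -!scalemxAr.
exact/cyc3_trilinear/d_omega_linear.
Qed.

Lemma torsionC X Y Z : torsion X Y Z = torsion Y Z X.
Proof. exact: cyc3C. Qed.

(** Adding half of [torsion] to the Levi-Civita connection changes 2 g((nabla_X A) Y, Z) by T(X, AY,
    Z) + T(X, Y, AZ), so the identity says that the modified connection preserves [A]. *)
Lemma hj_nabla_torsion X Y Z :
  2 * q X Y Z + (c X (A *m Y) Z + c (A *m Y) X Z - c Z X (A *m Y))
    + (c X Y (A *m Z) + c Y X (A *m Z) - c (A *m Z) X Y)
  = - torsion X (A *m Y) Z - torsion X Y (A *m Z).
Proof.
have tl : trilinear dw := cyc3_trilinear (d_omega_linear A g dA dg).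
rewrite hj_nabla /torsion !hj_AA.
have [_ -> _] := trilinearN Y (A *m X) (A *m Z) tl.
have [_ _ ->] := trilinearN Z (A *m X) (A *m Y) tl.
by rewrite !opprK.
Qed.

Variable s : F.
Hypotheses (two_neq0 : 2 != 0 :> F) (ss : s * s = -1).

(* Evaluate the vanishing Nijenhuis tensor on eigenvectors. *)
Lemma hj_eigen_sym t X Y : t = s \/ t = - s -> A *m X = t *: X -> A *m Y = t *: Y ->
  dA X *m Y = dA Y *m X.
Proof.
move=> tE AX AY.
have t_neq0 : 2 * t != 0.
  rewrite mulf_neq0 //; suff: t * t != 0 by rewrite mulf_eq0 orbb.
  by case: tE => ->; rewrite ?mulrNN ss oppr_eq0 oner_neq0.
have := hj_nijenhuis h X Y; rewrite AX AY !linearZ /= -!scalemxAl.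
have Ad U W : A *m W = t *: W -> A *m (dA U *m W) = - t *: (dA U *m W).
  move=> AW; rewrite mulmxA -[A *m _]opprK -(hj_dsq h) mulNmx -mulmxA AW.
  by rewrite -scalemxAr scaleNr.
rewrite !Ad // !scaleNr opprK -addrA [- _ + t *: _]addrC addrACA -opprD.
rewrite -!mulr2n -mulNrn -mulrnDl -!scaler_nat -scalerBr scalerA => /eqP.
by rewrite scaler_eq0 (negbTE t_neq0) subr_eq0 => /eqP.
Qed.
End OneJet.
End HermitianJets.

(** * Hyperhermitian 1-jets and Poisson 1-jets *)

Section HyperhermitianJets.
Variables (F : fieldType) (n : nat) (I J K g : 'M[F]_n).
Variables dI dJ dK dg : {linear 'cV[F]_n -> 'M[F]_n}.
Hypotheses (hI : hermitian_jet I g dI dg) (hJ : hermitian_jet J g dJ dg).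
Hypothesis hK : hermitian_jet K g dK dg.
Hypotheses (IJ : I *m J = K) (JI : J *m I = - K).
Hypothesis dJK : forall X, dJ X *m K + J *m dK X = dI X.
Hypothesis dJI : forall X, dJ X *m I + J *m dI X = - dK X.
Hypothesis two_neq0 : 2 != 0 :> F.
Implicit Types (s a b c : F) (X Y Z : 'cV[F]_n).
Let TI := torsion I g dI dg.
Let TJ := torsion J g dJ dg.
Let TK := torsion K g dK dg.

Lemma hc_JK : J *m K = I.
Proof. by rewrite -IJ mulmxA JI -IJ mulNmx -mulmxA (hj_sq hJ) mulmxN opprK mulmx1. Qed.

Lemma hc_KJ : K *m J = - I.
Proof. by rewrite -IJ -mulmxA (hj_sq hJ) mulmxN mulmx1. Qed.

(* If T_J = T_K =: T, the metric connection with totally skew torsion T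
   preserves J and K, hence I = JK; the connection with these properties being
   unique for I, T = T_I. *)
Lemma torsion_third : (forall X Y Z, TJ X Y Z = TK X Y Z) ->
  forall X Y Z, TI X Y Z = TJ X Y Z.
Proof.
move=> TJK.
(* The product rule for I = JK: the identity of [hj_nabla_torsion] for J at (X, KY, Z) minus the one
   for K at (X, Y, JZ) has the left hand side of the one for I at (X, Y, Z). The terms T(X, KY, JZ)
   cancel, and JK = I, KJ = - I leave the right hand side of [E]. *)
have E X Y Z : TI X (I *m Y) Z + TI X Y (I *m Z) = TJ X (I *m Y) Z + TJ X Y (I *m Z).
  have := hj_nabla_torsion hJ X (K *m Y) Z.
  have := hj_nabla_torsion hK X Y (J *m Z).
  have := hj_nabla_torsion hI X Y Z.
  rewrite -/TI -/TJ -/TK. rewrite -!TJK. rewrite !mulmxA hc_JK hc_KJ !mulNmx.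
  rewrite -{1}dJK mulmxDl bilDl -!mulmxA (hj_bil_A hJ).
  have [_ _ ->] := trilinearN (I *m Z) X Y (torsion_trilinear J g dJ dg : trilinear TJ).
  rewrite (linearN dg) !bilN !bilNr => eI eK eJ.
  apply: oppr_inj; rewrite [LHS]opprD [RHS]opprD -{}eI.
  rewrite [RHS](_ : _ = - TJ X (I *m Y) Z - TJ X (K *m Y) (J *m Z)
    - (- TJ X (K *m Y) (J *m Z) - - TJ X Y (I *m Z))); last by ring.
  rewrite -eJ -eK; ring.
have CI X Y Z : TI X Y Z = TI Y Z X by exact: torsionC.
have CJ X Y Z : TJ X Y Z = TJ Y Z X by exact: torsionC.
clearbody TI TJ; pose S X Y Z := TI X Y Z - TJ X Y Z.
have SE X Y Z : S X (mulmx I Y) Z = - S X Y (I *m Z).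
  by apply: subr0_eq; rewrite opprK /S addrACA E; ring.
have SC X Y Z : S X Y Z = S Y Z X by rewrite /S CI CJ.
(* This kills the difference on vectors of the form IX, hence everywhere, because X = - I (I X). *)
have S0 := cyclic_skew_eq0 two_neq0 SC SE.
move=> X Y Z; apply: subr0_eq; rewrite -/(S X Y Z) -[X]opprK -(hj_AA hI).
exact: S0.
Qed.

Let OJ := d_omega J g dJ dg.
Let OK := d_omega K g dK dg.

(** The coefficient is a parameter because both square roots of -1 occur: they give dOmega and the
    differential of the conjugate of Omega. *)
Definition theta s X Y Z := cyc3 OJ X Y Z + s * cyc3 OK X Y Z.

Lemma thetaC s X Y Z : theta s X Y Z = theta s Y Z X.
Proof. by rewrite /theta !(cyc3C _ X). Qed.

Lemma hj_J_eigen a X : I *m X = a *: X -> I *m (J *m X) = - a *: (J *m X).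
Proof.
by move=> IX; rewrite mulmxA IJ -[K]opprK -JI mulNmx -mulmxA IX -scalemxAr scaleNr.
Qed.

Lemma hj_K_eigen a X : I *m X = a *: X -> K *m X = - a *: (J *m X).
Proof. by move=> IX; rewrite -[K]opprK -JI mulNmx -mulmxA IX -scalemxAr scaleNr. Qed.

Lemma hj_bil_eigen s X Y : s * s = -1 -> I *m X = s *: X -> I *m Y = s *: Y ->
  bil g X Y = 0.
Proof.
move=> ss IX IY; have := hj_bil_A hI X Y; rewrite IX IY bilZl bilZr => /eqP.
rewrite -subr_eq0 opprK -mulr2n -mulr_natl !mulf_eq0 (negbTE two_neq0) /=.
case/orP => /eqP // s0; move: ss; rewrite s0 mul0r => /eqP.
by rewrite eq_sym oppr_eq0 oner_eq0.
Qed.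

(* Being d(omega_J + s omega_K), theta s has no component of type (1, 2) or
   (0, 3), as I is integrable. *)
Lemma theta_type s X Y Z : s * s = -1 -> I *m Y = - s *: Y -> I *m Z = - s *: Z ->
  theta s X Y Z = 0.
Proof.
move=> ss IY IZ; pose N U := OJ U + s *: OK U.
have thE : theta s X Y Z = bil (N X) Y Z + bil (N Y) Z X + bil (N Z) X Y.
  by rewrite /theta -cyc3DZ.
have N_alt U W W' : bil (N U) W W' = - bil (N U) W' W.
  rewrite -bil_tr /N linearD linearZ /= (d_omega_alt hJ) (d_omega_alt hK).
  by rewrite scalerN -opprD bilN.
(* On such W the matrix J + s K vanishes, so the derivative of g drops out. The derivatives of J and
   K that remain are traded for one of I by [dJI]. *)
have NE U (W : 'cV[F]_n) : I *m W = - s *: W -> N U *m W = s *: (g *m (J *m (dI U *m W))).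
  move=> IW; have KW : K *m W = s *: (J *m W) by rewrite (hj_K_eigen IW) opprK.
  rewrite /N /OJ /OK (hj_dherm hJ) (hj_dherm hK) scalerN -opprD scalerDr addrACA.
  rewrite mulNmx mulmxDl !mulmxDl -!scalemxAl -!mulmxA KW -!scalemxAr scalerA ss.
  rewrite scaleN1r subrr add0r scalemxAr -mulmxDr.
  have -> : s *: (dK U *m W) = - (dJ U *m W) - s *: (J *m (dI U *m W)).
    have := congr1 (fun M => s *: (M *m W)) (dJI U).
    rewrite mulmxDl -!mulmxA IW -scalemxAr scalerDr scalerA mulrN ss opprK scale1r.
    by rewrite mulNmx scalerN => e; rewrite -opprD e opprK.
  by rewrite addrA subrr add0r mulmxN opprK -scalemxAr.
have bilN' U (W W' : 'cV[F]_n) : I *m W = - s *: W ->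
    bil (N U) W' W = s * bil g W' (J *m (dI U *m W)).
  by move=> IW; rewrite /bil -mulmxA NE // -scalemxAr mxE -mulmxA.
have s's : - s * - s = -1 by rewrite mulrNN.
have IU : I *m (dI X *m Z) = s *: (dI X *m Z).
  rewrite mulmxA -[I *m _]opprK -(hj_dsq hI) mulNmx -mulmxA IZ -scalemxAr.
  by rewrite scaleNr opprK.
(* The term differentiated along X pairs two vectors of the (- s)-eigenspace, which g annihilates.
   The other two cancel by the symmetry [hj_eigen_sym], that is, by integrability of I. *)
rewrite thE bilN' // (hj_bil_eigen s's IY (hj_J_eigen IU)) mulr0 add0r.
rewrite N_alt !bilN' // (hj_eigen_sym hI two_neq0 s's _ IY IZ) ?addNr //.
by left.
Qed.

(** On the a-eigenspace of I one has K = - a J, so T_K is d omega_K on the vectors JX, JY, JZ with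
    the factor - a b c, while T_J is d omega_J on the same vectors. *)
Lemma torsion_eigen a b c X Y Z : I *m X = a *: X -> I *m Y = b *: Y ->
  I *m Z = c *: Z ->
  TJ X Y Z - TK X Y Z = theta (a * b * c) (J *m X) (J *m Y) (J *m Z).
Proof.
move=> IX IY IZ; rewrite /theta /TJ /TK /torsion.
rewrite (hj_K_eigen IX) (hj_K_eigen IY) (hj_K_eigen IZ).
have tl : trilinear (cyc3 OK) := cyc3_trilinear (d_omega_linear K g dK dg).
have [-> _ _] := trilinearZ (- a) (J *m X) (- b *: (J *m Y)) (- c *: (J *m Z)) tl.
have [_ -> _] := trilinearZ (- b) (J *m Y) (J *m X) (- c *: (J *m Z)) tl.
have [_ _ ->] := trilinearZ (- c) (J *m Z) (J *m X) (J *m Y) tl.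
by congr (_ + _); ring.
Qed.

Variable s : F.
Hypothesis ss : s * s = -1.

Lemma theta_torsion :
  (forall X Y Z, I *m X = s *: X -> I *m Y = s *: Y -> I *m Z = s *: Z ->
     theta s X Y Z = 0) ->
  (forall X Y Z, I *m X = - s *: X -> I *m Y = - s *: Y -> I *m Z = - s *: Z ->
     theta (- s) X Y Z = 0) ->
  forall X Y Z, TJ X Y Z = TK X Y Z.
Proof.
move=> th10 th01 X Y Z; apply: subr0_eq.
have tl : trilinear (fun X Y Z => TJ X Y Z - TK X Y Z).
  by apply: trilinearB; apply: torsion_trilinear.
apply: (@trilinear_eigen0 _ _ (mulmx I) _ two_neq0 ss _ _ tl) => [U|].
  exact: (hj_AA hI).
move=> a b c {}X {}Y {}Z aE bE cE IX IY IZ; rewrite (torsion_eigen IX IY IZ).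
move: (hj_J_eigen IX) (hj_J_eigen IY) (hj_J_eigen IZ).
have N0 r : r = s \/ r = - s -> r * r = -1 by case=> ->; rewrite ?mulrNN.
have s's : - s * - s = -1 by rewrite mulrNN.
(* J reverses eigenvalues. If two of a, b, c equal r and the third - r, then abc = r and two of the
   J-images have eigenvalue - r, so [theta_type] applies after a cyclic shift. If all equal r, then
   abc = - r and all three images have eigenvalue - r: these are the two hypotheses. *)
case: aE bE cE => -> [] -> [] ->; rewrite ?mulrNN ?opprK ?ss ?mulN1r ?mulNr ?mulrN
  ?ss ?opprK ?mul1r ?mulN1r ?opprK => JX JY JZ.
- exact: th01.
- by rewrite -thetaC; apply: theta_type.
- by rewrite thetaC; apply: theta_type.
- by apply: theta_type; rewrite ?opprK.
- exact: theta_type.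
- by rewrite thetaC; apply: theta_type; rewrite ?opprK.
- by rewrite -thetaC; apply: theta_type; rewrite ?opprK.
- exact: th10.
Qed.

Lemma torsion_theta : (forall X Y Z, TJ X Y Z = TK X Y Z) ->
  forall X Y Z, I *m X = s *: X -> I *m Y = s *: Y -> I *m Z = s *: Z ->
  theta s X Y Z = 0.
Proof.
move=> TJK X Y Z IX IY IZ.
have JN (U : 'cV[F]_n) : I *m U = s *: U -> I *m - (J *m U) = - s *: - (J *m U).
  by move=> IU; rewrite mulmxN scalerN (hj_J_eigen IU).
have JJ (U : 'cV[F]_n) : J *m - (J *m U) = U by rewrite mulmxN (hj_AA hJ) opprK.
(* X is the J-image of - JX, which has eigenvalue - s, and the cube of - s is s: so [theta s] is a
   value of T_J - T_K. *)
rewrite -(JJ X) -(JJ Y) -(JJ Z) [s](_ : s = - s * - s * - s).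
  by rewrite -(torsion_eigen (JN _ IX) (JN _ IY) (JN _ IZ)) TJK subrr.
by rewrite mulrNN ss mulN1r opprK.
Qed.

End HyperhermitianJets.

(** * Derivative of a bivector inverting a 2-form on a subbundle *)

Section PoissonJets.
Variables (F : fieldType) (n : nat) (P Om p : 'M[F]_n).
Variables dP dOm dp : 'cV[F]_n -> 'M[F]_n.
Hypotheses (P_alt : P^T = - P) (OmP : Om *m P = - p^T).
Hypothesis dP_Om : forall X, dP X *m Om + P *m dOm X = - dp X.
Hypothesis dP_p : forall X, dP X *m p^T + P *m (dp X)^T = dP X.
Hypothesis dp_sym : forall a b : 'rV[F]_n,
  dp (a *m P)^T *m (b *m P)^T = dp (b *m P)^T *m (a *m P)^T.

(** For p = 1 this is the derivative of P = - Om^-1. The two terms in [dp] are the price of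
    inverting only on the image of p. They arise by multiplying the derivative of P Om = - p by P on
    the right and recovering [dP] from its product with p^T. *)
Lemma dP_dOm X : dP X = dp X *m P + P *m (dp X)^T + P *m dOm X *m P.
Proof.
have := congr1 (mulmx^~ P) (dP_Om X).
rewrite /= mulmxDl -mulmxA OmP mulmxN mulNmx => e.
rewrite -[LHS]dP_p -[dp X *m P]opprK -e.
by rewrite opprD opprK addrAC subrK.
Qed.

(** Each of the three terms contributes two values of [dp] on A, B, E. By the symmetry [dp_sym]
    these six cancel in pairs around the cycle, and only the terms P dOm P remain. *)
Lemma schouten_dOm (a b e : 'rV[F]_n) :
  let A := (a *m P)^T in let B := (b *m P)^T in let E := (e *m P)^T in
  (b *m dP A *m e^T) 0 0 + (e *m dP B *m a^T) 0 0 + (a *m dP E *m b^T) 0 0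
  = - cyc3 dOm A B E.
Proof.
move=> A B E.
have term X (u v : 'rV[F]_n) : (u *m dP X *m v^T) 0 0 =
    (v *m (dp X *m (u *m P)^T)) 0 0 - (u *m (dp X *m (v *m P)^T)) 0 0
    - bil (dOm X) (u *m P)^T (v *m P)^T.
  have Pv : P *m v^T = - (v *m P)^T by rewrite trmx_mul P_alt mulNmx opprK.
  have D00 (M N : 'M[F]_1) : (M + N) 0 0 = M 0 0 + N 0 0 by rewrite mxE.
  have N00 (M : 'M[F]_1) : (- M) 0 0 = - M 0 0 by rewrite mxE.
  have T00 : (u *m P *m (dp X)^T *m v^T) 0 0 = (v *m (dp X *m (u *m P)^T)) 0 0.
    rewrite -[u *m P *m _ *m _]trmxK [LHS]mxE.
    by rewrite ![(_ *m _ *m v^T)^T]trmx_mul !trmxK (trmx_mul _ (dp X)^T) trmxK !mulmxA.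
  rewrite dP_dOm !(mulmxDl, mulmxDr) !D00 !mulmxA T00 /bil trmxK -!(mulmxA _ P) Pv.
  by rewrite !mulmxN !N00 !mulmxA; ring.
rewrite !term /cyc3 !(dp_sym b) (dp_sym a e); ring.
Qed.
End PoissonJets.

(** * Pointwise algebra of Omega, its inverse on (1, 0)-covectors and P *)

Section PoissonAlgebra.
Variables (F : fieldType) (n : nat) (I J K g h : 'M[F]_n) (s : F).
Hypotheses (two_neq0 : 2 != 0 :> F) (ss : s * s = -1).
Hypotheses (II : I *m I = - 1%:M) (JJ : J *m J = - 1%:M).
Hypotheses (IJ : I *m J = K) (JI : J *m I = - K).
Hypotheses (gI : I^T *m g = - (g *m I)) (gJ : J^T *m g = - (g *m J)).
Hypothesis gK : K^T *m g = - (g *m K).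
Hypotheses (g_sym : g^T = g) (hg : h *m g = 1%:M).

Let Om := J^T *m g + s *: (K^T *m g).
Let p := 2^-1 *: (1%:M - s *: I).
Let P := - 4^-1 *: ((J - s *: K) *m h).

Let gh : g *m h = 1%:M. Proof. exact: mulmx1C. Qed.
Let JK : J *m K = I.
Proof. by rewrite -IJ mulmxA JI -IJ mulNmx -mulmxA JJ mulmxN opprK mulmx1. Qed.
Let KJ : K *m J = - I. Proof. by rewrite -IJ -mulmxA JJ mulmxN mulmx1. Qed.
Let IK : I *m K = - J. Proof. by rewrite -IJ mulmxA II mulNmx mul1mx. Qed.
Let KK : K *m K = - 1%:M. Proof. by rewrite -{1}IJ -mulmxA JK II. Qed.

Let h_sym : h^T = h.
Proof. by rewrite -[h^T]mulmx1 -gh mulmxA -{1}g_sym -trmx_mul gh trmx1 mul1mx. Qed.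

Let h_skew A : A^T *m g = - (g *m A) -> h *m A^T = - (A *m h).
Proof.
move=> gA; rewrite -[h *m A^T]mulmx1 -gh -!mulmxA (mulmxA _ g) gA mulNmx mulmxN.
by rewrite !mulmxA hg mul1mx.
Qed.

Let four_neq0 : 4 != 0 :> F.
Proof. by rewrite -[4%N]/(2 * 2)%N natrM mulf_neq0. Qed.

Lemma OmegaE : Om = - (g *m (J + s *: K)).
Proof. by rewrite /Om gJ gK scalerN -opprD mulmxDr -scalemxAr. Qed.

Lemma Omega_alt : Om^T = - Om.
Proof.
rewrite {2}OmegaE opprK /Om linearD linearZ /= !trmx_mul !trmxK g_sym.
by rewrite mulmxDr -scalemxAr.
Qed.

Lemma P_alt : P^T = - P.
Proof.
rewrite /P linearZ /= trmx_mul h_sym linearB /= linearZ /= mulmxBr -scalemxAr.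
rewrite !h_skew // -[RHS]scalerN; congr (_ *: _).
by rewrite mulmxBl -scalemxAl scalerN opprK opprB addrC.
Qed.

Let pT : p^T = 2^-1 *: (1%:M - s *: I^T).
Proof. by apply/matrixP => i j; rewrite !mxE eq_sym. Qed.

Lemma Omega_P : Om *m P = - p^T.
Proof.
rewrite OmegaE /P mulNmx -scalemxAr scaleNr opprK -mulmxA (mulmxA (J + _)).
(* The product is -4 times the projection onto the (- s)-eigenspace of I, hence the factor 4^-1 in
   [P]. Conjugation by g replaces I with - I^T and turns this projection into p^T. *)
have -> : (J + s *: K) *m (J - s *: K) = - 2 *: (1%:M + s *: I).
  rewrite mulmxBr !mulmxDl -!scalemxAr -!scalemxAl JJ KK JK KJ scalerA ss.
  by apply/matrixP => i j; rewrite !mxE; ring.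
have gIh : g *m I *m h = - I^T by rewrite -[g *m I]opprK -gI mulNmx -mulmxA gh mulmx1.
rewrite -scalemxAl -scalemxAr mulmxDl mulmxDr mul1mx gh -scalemxAl -scalemxAr.
rewrite mulmxA gIh pT.
apply/matrixP => i j; rewrite !mxE.
by field; rewrite two_neq0.
Qed.

Lemma P_Omega : P *m Om = - p.
Proof.
by rewrite -[P *m Om]trmxK trmx_mul Omega_alt P_alt mulNmx mulmxN opprK Omega_P
  linearN /= trmxK.
Qed.

Lemma I_P : I *m P = s *: P.
Proof.
rewrite /P -scalemxAr scalerA mulrC -scalerA mulmxA; congr (_ *: _).
rewrite mulmxBr -scalemxAr IJ IK scalemxAl; congr (_ *m _).
by rewrite scalerBr scalerA ss scalerN !opprK scaleN1r opprK addrC.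
Qed.

Lemma p_P : p *m P = P.
Proof.
rewrite /p -scalemxAl mulmxBl mul1mx -scalemxAl I_P scalerA ss scaleN1r opprK.
by rewrite -mulr2n -scaler_nat scalerA mulVf // scale1r.
Qed.

Lemma P_p : P *m p^T = P.
Proof. by rewrite -[LHS]trmxK trmx_mul trmxK P_alt mulmxN p_P linearN /= P_alt opprK. Qed.

Lemma covec01_P (a : 'rV[F]_n) : a *m I = - s *: a -> a *m P = 0.
Proof.
move=> aI; have ap : a *m p = 0.
  rewrite /p -scalemxAr mulmxBr mulmx1 -scalemxAr aI scalerA mulrN ss opprK.
  by rewrite scale1r subrr scaler0.
by rewrite -p_P mulmxA ap mul0mx.
Qed.

(** On the s-eigenspace of I, J + s K equals 2 J, so the equation i_Z Omega = a reads 2 g J Z = a^T;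
    this is its solution, as J^-1 = - J. *)
Definition Omega_raise (a : 'rV[F]_n) : 'cV[F]_n := - 2^-1 *: (J *m h *m a^T).

Lemma Omega_raise10 a : a *m I = s *: a -> I *m Omega_raise a = s *: Omega_raise a.
Proof.
move=> aI; rewrite /Omega_raise -scalemxAr !mulmxA IJ -[K]opprK -JI !mulNmx.
have Ih : I *m h = - (h *m I^T) by rewrite h_skew // opprK.
rewrite -(mulmxA J I h) Ih mulmxN mulNmx opprK -!mulmxA -trmx_mul aI.
by rewrite linearZ /= -!scalemxAr !scalerA mulrC.
Qed.

Lemma Omega_raiseK a : a *m I = s *: a -> (Omega_raise a)^T *m Om = a.
Proof.
move=> aI; rewrite -[LHS]trmxK trmx_mul trmxK Omega_alt OmegaE opprK.
rewrite -mulmxA mulmxDl -scalemxAl.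
have -> : K *m Omega_raise a = - s *: (J *m Omega_raise a).
  by rewrite -[K]opprK -JI mulNmx -mulmxA Omega_raise10 // -scalemxAr scaleNr.
rewrite scalerA mulrN ss opprK scale1r -mulr2n -scaler_nat /Omega_raise.
rewrite -!scalemxAr scalerA mulrN divff // !mulmxA -(mulmxA g J J) JJ.
by rewrite !mulmxN mulmx1 !mulNmx gh mul1mx scaleN1r opprK trmxK.
Qed.

Lemma Omega_inj10 (Z : 'cV[F]_n) : I *m Z = s *: Z -> Z^T *m Om = 0 -> Z = 0.
Proof.
move=> IZ /(congr1 trmx); rewrite trmx_mul trmxK Omega_alt OmegaE opprK trmx0.
rewrite -mulmxA mulmxDl -scalemxAl -[K]opprK -JI mulNmx -mulmxA IZ.
rewrite -scalemxAr scalerN scalerA ss scaleN1r opprK.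
move/(congr1 (mulmx (J *m h))); rewrite mulmx0 mulmxA -(mulmxA J h) hg mulmx1.
rewrite -mulmxDr mulmxA JJ mulNmx mul1mx -mulr2n -scaler_nat => /eqP.
by rewrite oppr_eq0 scaler_eq0 (negbTE two_neq0) => /eqP.
Qed.

(** From K = IJ one gets a K = s a J, so a (J - s K) = 2 a J. This reconciles the factor 4^-1 of [P]
    with the 2^-1 of [Omega_raise]. *)
Lemma Omega_raise_P (a b : 'rV[F]_n) : a *m I = s *: a ->
  (Omega_raise a)^T *m Om *m Omega_raise b = a *m P *m b^T.
Proof.
move=> aI; rewrite Omega_raiseK // /Omega_raise /P -!scalemxAr -scalemxAl !mulmxA.
rewrite mulmxBr -scalemxAr -IJ mulmxA aI -scalemxAl scalerA ss scaleN1r opprK.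
rewrite -mulr2n -scaler_nat -!scalemxAl scalerA; congr (_ *: _).
by field; rewrite ?two_neq0 ?four_neq0.
Qed.
End PoissonAlgebra.

(** * From real to complex arguments in the Nijenhuis tensor *)

Section NijenhuisPolarization.
Variables (F : fieldType) (n : nat) (A : 'M[F]_n).
Variable D : {linear 'cV[F]_n -> 'M[F]_n}.
Implicit Types X Y : 'cV[F]_n.

Definition nijenhuis_jet X Y := D (A *m X) *m Y - D (A *m Y) *m X
    + A *m (D Y *m X) - A *m (D X *m Y).

Lemma nijenhuis_jetC X Y : nijenhuis_jet X Y = - nijenhuis_jet Y X.
Proof. by rewrite /nijenhuis_jet !opprD !opprK [- _ + _ in RHS]addrC -!addrA;
 congr (_ + (_ + _)); rewrite addrC. Qed.

Lemma nijenhuis_jet_linear X : linear (nijenhuis_jet X).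
Proof.
move=> a Y Y'; rewrite /nijenhuis_jet.
have -> : A *m (a *: Y + Y') = a *: (A *m Y) + A *m Y'.
  by rewrite mulmxDr -scalemxAr.
have -> : D (A *m X) *m (a *: Y + Y') = a *: (D (A *m X) *m Y) + D (A *m X) *m Y'.
  by rewrite mulmxDr -scalemxAr.
have -> : D X *m (a *: Y + Y') = a *: (D X *m Y) + D X *m Y'.
  by rewrite mulmxDr -scalemxAr.
rewrite !linearP /= !mulmxDl -!scalemxAl !mulmxDr -!scalemxAr.
move: (_ *m Y) (_ *m Y') (_ *m X) (_ *m X) (_ *m _) (_ *m _) (_ *m _) (_ *m _).
move=> m1 m2 m3 m4 m5 m6 m7 m8.
by apply/matrixP => i j; rewrite !mxE; ring.
Qed.

(** Integrability is given on real vector fields but is used on eigenvectors of [A], which are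
    complex. [rl] stands for being real, and linearity in the second argument with antisymmetry
    gives bilinearity. *)
Lemma nijenhuis_jet_real (s : F) (rl : 'cV[F]_n -> Prop) :
  (forall X, exists Y Y', [/\ X = Y + s *: Y', rl Y & rl Y']) ->
  (forall X Y, rl X -> rl Y -> nijenhuis_jet X Y = 0) ->
  forall X Y, nijenhuis_jet X Y = 0.
Proof.
move=> dec N0.
have N1 X Y : rl X -> nijenhuis_jet X Y = 0.
  move=> rX; have [Y1 [Y2 [-> r1 r2]]] := dec Y.
  by rewrite addrC nijenhuis_jet_linear !N0 // scaler0 addr0.
move=> X Y; have [X1 [X2 [-> r1 r2]]] := dec X.
rewrite nijenhuis_jetC addrC nijenhuis_jet_linear.
by rewrite !(nijenhuis_jetC Y) !N1 // oppr0 scaler0 addr0 oppr0.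
Qed.
End NijenhuisPolarization.

Require Import Defs.
From mathcomp Require Import complex zify.
From mathcomp Require Import all_classical all_reals all_analysis.
Import Order.TTheory GRing.Theory Num.Theory.
Import numFieldNormedType.Exports.
Local Open Scope classical_set_scope.
Local Open Scope ring_scope.

(** * Complex directional derivatives *)

Section ComplexDerivative.
Variables (R : realType) (n : nat).
Local Notation C := R[i].
Implicit Types (f g : 'cV[R]_n -> C) (w : 'cV[C]_n) (x : 'cV[R]_n).
Local Notation Re := complex.Re.
Local Notation Im := complex.Im.

Lemma complex_eq (u v : C) : Re u = Re v -> Im u = Im v -> u = v.
Proof. by case: u v => [a b] [c d] /= -> ->. Qed.

Lemma cReM (u v : C) : Re (u * v) = Re u * Re v - Im u * Im v.
Proof. by case: u v => [a b] [c d]. Qed.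

Lemma cImM (u v : C) : Im (u * v) = Re u * Im v + Im u * Re v.
Proof. by case: u v => [a b] [c d]. Qed.

Lemma cReD (u v : C) : Re (u + v) = Re u + Re v.
Proof. by case: u v => [a b] [c d]. Qed.

Lemma cImD (u v : C) : Im (u + v) = Im u + Im v.
Proof. by case: u v => [a b] [c d]. Qed.

Lemma cderiveE w f x : cderive w f x =
  Complex ('D_(re_mx w) (fun y => Re (f y)) x - 'D_(im_mx w) (fun y => Im (f y)) x)
    ('D_(re_mx w) (fun y => Im (f y)) x + 'D_(im_mx w) (fun y => Re (f y)) x).
Proof.
rewrite /cderive /cderive_real /ii.
move: ('D__ _ x) ('D__ _ x) ('D__ _ x) ('D__ _ x) => a b c d.
by apply: complex_eq; rewrite !(cReD, cReM, cImD, cImM) /=; ring.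
Qed.

Definition cdiff f x :=
  differentiable (fun y => Re (f y)) x /\ differentiable (fun y => Im (f y)) x.

Lemma derivelP (f : 'cV[R]_n -> R) x a u v : differentiable f x ->
  'D_(a *: u + v) f x = a * 'D_u f x + 'D_v f x.
Proof. by move=> df; rewrite !deriveE // linearP. Qed.

Lemma re_mxP m p a (w w' : 'M[C]_(m, p)) :
  re_mx (a *: w + w') = Re a *: re_mx w + (- Im a *: im_mx w + re_mx w').
Proof. by apply/matrixP => i j; rewrite !mxE cReD cReM; ring. Qed.

Lemma im_mxP m p a (w w' : 'M[C]_(m, p)) :
  im_mx (a *: w + w') = Re a *: im_mx w + (Im a *: re_mx w + im_mx w').
Proof. by apply/matrixP => i j; rewrite !mxE cImD cImM; ring. Qed.

Lemma cderivelP f x : cdiff f x -> scalar (fun w => cderive w f x).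
Proof.
move=> [dr di] a w w'; rewrite !cderiveE re_mxP im_mxP !derivelP //.
do 8?move: ('D__ _ x) => ?.
by apply: complex_eq; rewrite !(cReD, cReM, cImD, cImM) /=; ring.
Qed.

Lemma near_eq_cderive w f g x : (\near x, f x = g x) -> cderive w f x = cderive w g x.
Proof.
move=> fg; rewrite !cderiveE.
have re : \near x, Re (f x) = Re (g x) by apply: filterS fg => y ->.
have im : \near x, Im (f x) = Im (g x) by apply: filterS fg => y ->.
by rewrite !(near_eq_derive _ re) !(near_eq_derive _ im).
Qed.

Lemma cdiff_cst c x : cdiff (fun=> c) x.
Proof. by split; apply: differentiable_cst. Qed.

Lemma cderive_cst w c x : cderive w (fun=> c) x = 0.
Proof. by rewrite cderiveE !derive_cst; apply: complex_eq => /=; ring. Qed.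

Lemma cReD_fun f g : (fun y => Re (f y + g y)) = (fun y => Re (f y)) + (fun y => Re (g y)).
Proof. by apply/funext => y; rewrite cReD. Qed.

Lemma cImD_fun f g : (fun y => Im (f y + g y)) = (fun y => Im (f y)) + (fun y => Im (g y)).
Proof. by apply/funext => y; rewrite cImD. Qed.

Lemma cReM_fun f g : (fun y => Re (f y * g y)) =
  (fun y => Re (f y)) * (fun y => Re (g y)) - (fun y => Im (f y)) * (fun y => Im (g y)).
Proof. by apply/funext => y; rewrite cReM. Qed.

Lemma cImM_fun f g : (fun y => Im (f y * g y)) =
  (fun y => Re (f y)) * (fun y => Im (g y)) + (fun y => Im (f y)) * (fun y => Re (g y)).
Proof. by apply/funext => y; rewrite cImM. Qed.

Lemma cdiffD f g x : cdiff f x -> cdiff g x -> cdiff (fun y => f y + g y) x.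
Proof.
by move=> [fr fi] [gr gi]; split; rewrite ?cReD_fun ?cImD_fun; apply: differentiableD.
Qed.

Lemma cderiveD w f g x : cdiff f x -> cdiff g x ->
  cderive w (fun y => f y + g y) x = cderive w f x + cderive w g x.
Proof.
move=> [fr fi] [gr gi]; rewrite !cderiveE cReD_fun cImD_fun.
rewrite !deriveD; do ?exact: diff_derivable.
do 8?move: ('D__ _ x) => ?.
by apply: complex_eq; rewrite !(cReD, cReM, cImD, cImM) /=; ring.
Qed.

Lemma cdiffM f g x : cdiff f x -> cdiff g x -> cdiff (fun y => f y * g y) x.
Proof.
move=> [fr fi] [gr gi]; split; rewrite ?cReM_fun ?cImM_fun.
  by apply: differentiableB; apply: differentiableM.
by apply: differentiableD; apply: differentiableM.
Qed.

Lemma cderiveM w f g x : cdiff f x -> cdiff g x ->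
  cderive w (fun y => f y * g y) x = cderive w f x * g x + f x * cderive w g x.
Proof.
move=> [fr fi] [gr gi]; rewrite !cderiveE cReM_fun cImM_fun.
have D h v : differentiable h x -> derivable h x v by exact: diff_derivable.
have DM (h k : 'cV[R]_n -> R) v : differentiable h x -> differentiable k x ->
    derivable (h * k) x v by move=> ? ?; apply: derivableM; exact: D.
have M (h k : 'cV[R]_n -> R) v : differentiable h x -> differentiable k x ->
    'D_v (h * k) x = h x * 'D_v k x + k x * 'D_v h x.
  by move=> dh dk; apply: deriveM; exact: D.
rewrite !deriveB ?deriveD ?M //; do ?exact: DM.
do 8?move: ('D__ _ x) => ?.
by apply: complex_eq; rewrite !(cReD, cReM, cImD, cImM) /=; ring.
Qed.

Lemma cdiff_sum (T : Type) (r : seq T) (F : T -> 'cV[R]_n -> C) x :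
  (forall i, cdiff (F i) x) -> cdiff (fun y => \sum_(i <- r) F i y) x.
Proof.
move=> dF; elim: r => [|i r IH].
  by under eq_fun do rewrite big_nil; exact: cdiff_cst.
by under eq_fun do rewrite big_cons; exact: cdiffD.
Qed.

Lemma cderive_sum w (T : Type) (r : seq T) (F : T -> 'cV[R]_n -> C) x :
  (forall i, cdiff (F i) x) ->
  cderive w (fun y => \sum_(i <- r) F i y) x = \sum_(i <- r) cderive w (F i) x.
Proof.
move=> dF; elim: r => [|i r IH].
  by under eq_fun do rewrite big_nil; rewrite big_nil cderive_cst.
under eq_fun do rewrite big_cons.
by rewrite big_cons cderiveD ?IH //; exact: cdiff_sum.
Qed.
End ComplexDerivative.

(** * Entrywise complex derivatives of matrix-valued functions *)

Section MatrixDerivative.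
Variables (R : realType) (n : nat).
Local Notation C := R[i].
Local Notation Re := complex.Re.
Local Notation Im := complex.Im.
Implicit Types (w : 'cV[C]_n) (x : 'cV[R]_n).

Definition cdiffmx m p (F : 'cV[R]_n -> 'M[C]_(m, p)) x :=
  forall i j, cdiff (fun y => F y i j) x.

Definition cdmx m p w (F : 'cV[R]_n -> 'M[C]_(m, p)) x : 'M[C]_(m, p) :=
  \matrix_(i, j) cderive w (fun y => F y i j) x.

Lemma cdmxE m p w (F : 'cV[R]_n -> 'M[C]_(m, p)) x i j :
  cdmx w F x i j = cderive w (fun y => F y i j) x.
Proof. by rewrite mxE. Qed.

Lemma cdmx_linear m p (F : 'cV[R]_n -> 'M[C]_(m, p)) x :
  cdiffmx F x -> linear (fun w => cdmx w F x).
Proof.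
move=> dF a w w'; apply/matrixP => i j.
by rewrite cdmxE cderivelP // -!cdmxE [RHS]mxE [in RHS]mxE.
Qed.

Lemma near_eq_cdmx m p w (F G : 'cV[R]_n -> 'M[C]_(m, p)) x :
  (\near x, F x = G x) -> cdmx w F x = cdmx w G x.
Proof.
move=> FG; apply/matrixP => i j; rewrite !cdmxE; apply: near_eq_cderive.
by apply: filterS FG => y ->.
Qed.

Lemma cdiffmx_cst m p (M : 'M[C]_(m, p)) x : cdiffmx (fun=> M) x.
Proof. by move=> i j; exact: cdiff_cst. Qed.

Lemma cdmx_cst m p w (M : 'M[C]_(m, p)) x : cdmx w (fun=> M) x = 0.
Proof. by apply/matrixP => i j; rewrite cdmxE cderive_cst mxE. Qed.

Lemma cdiffmxD m p (F G : 'cV[R]_n -> 'M[C]_(m, p)) x :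
  cdiffmx F x -> cdiffmx G x -> cdiffmx (fun y => F y + G y) x.
Proof. by move=> dF dG i j; under eq_fun do rewrite mxE; exact: cdiffD. Qed.

Lemma cdmxD m p w (F G : 'cV[R]_n -> 'M[C]_(m, p)) x :
  cdiffmx F x -> cdiffmx G x ->
  cdmx w (fun y => F y + G y) x = cdmx w F x + cdmx w G x.
Proof.
move=> dF dG; apply/matrixP => i j; rewrite [RHS]mxE !cdmxE.
by rewrite -(cderiveD w (dF i j) (dG i j)); under eq_fun do rewrite mxE.
Qed.

Lemma cdiffmxM m p q (F : 'cV[R]_n -> 'M[C]_(m, p)) (G : 'cV[R]_n -> 'M[C]_(p, q)) x :
  cdiffmx F x -> cdiffmx G x -> cdiffmx (fun y => F y *m G y) x.
Proof.
move=> dF dG i j; under eq_fun do rewrite mxE.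
by apply: cdiff_sum => k; exact: cdiffM.
Qed.

Lemma cdmxM m p q w (F : 'cV[R]_n -> 'M[C]_(m, p)) (G : 'cV[R]_n -> 'M[C]_(p, q)) x :
  cdiffmx F x -> cdiffmx G x ->
  cdmx w (fun y => F y *m G y) x = cdmx w F x *m G x + F x *m cdmx w G x.
Proof.
move=> dF dG; apply/matrixP => i j; rewrite cdmxE [RHS]mxE [X in X + _]mxE [X in _ + X]mxE.
under eq_fun do rewrite mxE.
rewrite cderive_sum => [|k]; last exact: cdiffM.
by rewrite -big_split; apply: eq_bigr => k _; rewrite !cdmxE (cderiveM w (dF i k) (dG k j)).
Qed.

Lemma cdiffmxZ m p a (F : 'cV[R]_n -> 'M[C]_(m, p)) x :
  cdiffmx F x -> cdiffmx (fun y => a *: F y) x.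
Proof.
move=> dF i j; under eq_fun do rewrite mxE.
by exact: (cdiffM (cdiff_cst a x) (dF i j)).
Qed.

Lemma cdmxZ m p w a (F : 'cV[R]_n -> 'M[C]_(m, p)) x :
  cdiffmx F x -> cdmx w (fun y => a *: F y) x = a *: cdmx w F x.
Proof.
move=> dF; apply/matrixP => i j; rewrite [RHS]mxE !cdmxE.
under eq_fun do rewrite mxE.
by rewrite (cderiveM w (cdiff_cst a x) (dF i j)) cderive_cst mul0r add0r.
Qed.

Lemma cdiffmxN m p (F : 'cV[R]_n -> 'M[C]_(m, p)) x :
  cdiffmx F x -> cdiffmx (fun y => - F y) x.
Proof.
have -> : (fun y => - F y) = (fun y => -1 *: F y).
  by apply/funext => y; rewrite scaleN1r.
exact: cdiffmxZ.
Qed.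

Lemma cdmxN m p w (F : 'cV[R]_n -> 'M[C]_(m, p)) x :
  cdiffmx F x -> cdmx w (fun y => - F y) x = - cdmx w F x.
Proof.
move=> dF; have -> : (fun y => - F y) = (fun y => -1 *: F y).
  by apply/funext => y; rewrite scaleN1r.
by rewrite (cdmxZ _ _ dF) scaleN1r.
Qed.

Lemma cdiffmx_tr m p (F : 'cV[R]_n -> 'M[C]_(m, p)) x :
  cdiffmx F x -> cdiffmx (fun y => (F y)^T) x.
Proof. by move=> dF i j; under eq_fun do rewrite mxE. Qed.

Lemma cdmx_tr m p w (F : 'cV[R]_n -> 'M[C]_(m, p)) x :
  cdmx w (fun y => (F y)^T) x = (cdmx w F x)^T.
Proof. by apply/matrixP => i j; rewrite [RHS]mxE !cdmxE; under eq_fun do rewrite mxE. Qed.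

Lemma cderive_mulmx m w (F : 'cV[R]_n -> 'M[C]_m) (u : 'rV[C]_m) (v : 'cV[C]_m) x :
  cdiffmx F x ->
  cderive w (fun y => (u *m F y *m v) 0 0) x = (u *m cdmx w F x *m v) 0 0.
Proof.
move=> dF; have du := @cdiffmx_cst _ _ u x; have dv := @cdiffmx_cst _ _ v x.
have <- : cdmx w (fun y => u *m F y *m v) x = u *m cdmx w F x *m v.
  rewrite cdmxM //; last exact: cdiffmxM.
  by rewrite cdmxM // !cdmx_cst mul0mx mulmx0 add0r addr0.
by rewrite cdmxE.
Qed.

Lemma cdiffmx_cplx m p (F : 'cV[R]_n -> 'M[R]_(m, p)) x :
  differentiable F x -> cdiffmx (fun y => cplx (F y)) x.
Proof.
move=> dF i j; split; under eq_fun do rewrite mxE /=; last exact: differentiable_cst.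
exact: (differentiable_comp dF (differentiable_coord _ i j)).
Qed.

Lemma re_cplx m p (M : 'M[R]_(m, p)) : re_mx (cplx M) = M.
Proof. by apply/matrixP => i j; rewrite !mxE. Qed.

Lemma im_cplx m p (M : 'M[R]_(m, p)) : im_mx (cplx M) = 0.
Proof. by apply/matrixP => i j; rewrite !mxE. Qed.

Lemma re_im_mxE m p (M : 'M[C]_(m, p)) : M = cplx (re_mx M) + ii R *: cplx (im_mx M).
Proof. by apply/matrixP => i j; rewrite !mxE; exact: complexE. Qed.

Lemma cdmx_cplx m p (F : 'cV[R]_n -> 'M[R]_(m, p)) v x :
  differentiable F x -> cdmx (cplx v) (fun y => cplx (F y)) x = cplx ('D_v F x).
Proof.
move=> dF; rewrite (derive_mx (diff_derivable dF)).
apply/matrixP => i j; rewrite cdmxE [RHS]mxE [in RHS]mxE.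
rewrite cderiveE re_cplx im_cplx !derive0 subr0 addr0.
by under eq_fun do rewrite mxE /=;
  under [X in Complex _ ('D__ X x)]eq_fun do rewrite mxE /=; rewrite derive_cst.
Qed.

Definition cconj_mx m p (M : 'M[C]_(m, p)) : 'M[C]_(m, p) := map_mx conjc M.

Lemma cdmx_conj m p (F : 'cV[R]_n -> 'M[R]_(m, p)) w x : differentiable F x ->
  cdmx (cconj_mx w) (fun y => cplx (F y)) x = cconj_mx (cdmx w (fun y => cplx (F y)) x).
Proof.
move=> dF; have lin := cdmx_linear (cdiffmx_cplx dF).
rewrite [in RHS](re_im_mxE w) [cplx (re_mx w) + _]addrC lin !cdmx_cplx //.
have -> : cconj_mx w = (- ii R) *: cplx (im_mx w) + cplx (re_mx w).
  by apply/matrixP => i j; rewrite !mxE; apply: complex_eq; case: (w i j) => a b;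
    rewrite !(cReD, cImD, cReM, cImM) /=; ring.
rewrite lin !cdmx_cplx //; move: ('D__ F x) ('D__ F x) => A B.
apply/matrixP => i j; rewrite !mxE.
by apply: complex_eq; rewrite !(cReD, cImD, cReM, cImM) /=; ring.
Qed.
End MatrixDerivative.

(** * Smooth functions on an open set *)

Section SmoothFunctions.
Variables (R : realType) (n : nat) (U : set 'cV[R]_n).
Hypothesis oU : open U.

Lemma eq_near_open (T : Type) (f g : 'cV[R]_n -> T) x :
  {in U, f =1 g} -> U x -> \near x, f x = g x.
Proof. by move=> fg Ux; near=> y; apply: fg; rewrite inE; near: y; exact: open_nbhs_nbhs.
Unshelve. all: by end_near. Qed.

Lemma near_eq_differentiable (V : normedModType R) (f g : 'cV[R]_n -> V) x :
  (\near x, f x = g x) -> differentiable f x -> differentiable g x.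
Proof.
move=> fg df; have fgx : f x = g x := nbhs_singleton fg.
have gE : g \o shift x = cst (g x) + 'd f x +o_ 0 id.
  apply/eqaddoP => e e0; have /eqaddoP/(_ e e0) := diff_locally df.
  move: fg; rewrite (near_shift 0) subr0; apply: filterS2 => y /= fgy.
  by rewrite !fctE /= -fgy fgx.
apply/diff_locallyP; rewrite (diff_unique (diff_continuous df) gE).
by split=> //; exact: diff_continuous.
Qed.

Lemma eq_Ck_on (V : normedModType R) k (f g : 'cV[R]_n -> V) :
  {in U, f =1 g} -> Ck_on k U f -> Ck_on k U g.
Proof.
elim: k f g => [|k IH] f g fg /=.
  move=> cf x Ux; suff : g @ x --> f x by rewrite fg ?inE.
  exact: cvg_trans (near_eq_cvg (eq_near_open fg Ux)) (cf x Ux).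
move=> [df Df]; split=> [x Ux|v].
  exact: near_eq_differentiable (eq_near_open fg Ux) (df x Ux).
apply: IH (Df v) => x; rewrite inE => Ux.
exact/near_eq_derive/eq_near_open.
Qed.

Lemma Ck_onS (V : normedModType R) k (f : 'cV[R]_n -> V) :
  Ck_on k.+1 U f -> Ck_on k U f.
Proof.
elim: k f => [|k IH] f [df Df].
  by move=> x Ux; apply/differentiable_continuous/df.
by split=> // v; apply: IH; exact: Df.
Qed.

Lemma Ck_on_cst (V : normedModType R) k (c : V) : Ck_on k U (fun=> c).
Proof.
elim: k c => [|k IH] c; first by move=> x _; exact: cst_continuous.
split=> [x _|v]; first exact: differentiable_cst.
by apply: eq_Ck_on (IH 0) => x _; rewrite [RHS]derive_cst.
Qed.

Lemma Ck_onD (V : normedModType R) k (f g : 'cV[R]_n -> V) :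
  Ck_on k U f -> Ck_on k U g -> Ck_on k U (fun y => f y + g y).
Proof.
elim: k f g => [|k IH] f g.
  by move=> cf cg x Ux; exact: continuousD (cf x Ux) (cg x Ux).
move=> [df Df] [dg Dg]; split=> [x Ux|v].
  by apply: differentiableD; [exact: df|exact: dg].
apply: eq_Ck_on (IH _ _ (Df v) (Dg v)) => x; rewrite inE => Ux.
by rewrite deriveD //; apply: diff_derivable; [exact: df|exact: dg].
Qed.

Lemma Ck_onM k (f g : 'cV[R]_n -> R) :
  Ck_on k U f -> Ck_on k U g -> Ck_on k U (fun y => f y * g y).
Proof.
elim: k f g => [|k IH] f g.
  by move=> cf cg x Ux; exact: continuousM (cf x Ux) (cg x Ux).
move=> [df Df] [dg Dg]; split=> [x Ux|v].
  by apply: differentiableM; [exact: df|exact: dg].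
have fk : Ck_on k U f by apply: Ck_onS; split.
have gk : Ck_on k U g by apply: Ck_onS; split.
apply: eq_Ck_on (Ck_onD (IH _ _ fk (Dg v)) (IH _ _ gk (Df v))) => x.
rewrite inE => Ux.
by rewrite deriveM //; apply: diff_derivable; [exact: df|exact: dg].
Qed.

Lemma Ck_onV k (f : 'cV[R]_n -> R) : (forall x, U x -> f x != 0) ->
  Ck_on k U f -> Ck_on k U (fun y => (f y)^-1).
Proof.
move=> f0; elim: k => [|k IH].
  by move=> cf x Ux; exact: continuousV (f0 x Ux) (cf x Ux).
move=> Cf; have [df Df] := Cf; split=> [x Ux|v].
  by apply: differentiableV; [exact: df|exact: f0].
have fk := IH (Ck_onS Cf).
have H := Ck_onM (Ck_onM (Ck_on_cst k (-1 : R)) (Ck_onM fk fk)) (Df v).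
apply: eq_Ck_on H => x.
rewrite inE => Ux; rewrite deriveV; [|exact: f0|by apply/diff_derivable/df].
by rewrite mulN1r -invfM -expr2.
Qed.

Lemma Ck_on_sum k (T : Type) (r : seq T) (P : pred T) (f : T -> 'cV[R]_n -> R) :
  (forall i, Ck_on k U (f i)) -> Ck_on k U (fun y => \sum_(i <- r | P i) f i y).
Proof.
move=> Cf; elim: r => [|i r IH].
  by apply: eq_Ck_on (Ck_on_cst k (0 : R)) => x _; rewrite big_nil.
under eq_fun do rewrite big_cons; case: (P i) => //.
exact: Ck_onD.
Qed.

Lemma Ck_on_prod k (T : Type) (r : seq T) (f : T -> 'cV[R]_n -> R) :
  (forall i, Ck_on k U (f i)) -> Ck_on k U (fun y => \prod_(i <- r) f i y).
Proof.
move=> Cf; elim: r => [|i r IH].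
  by apply: eq_Ck_on (Ck_on_cst k (1 : R)) => x _; rewrite big_nil.
by under eq_fun do rewrite big_cons; exact: Ck_onM.
Qed.

Lemma mx_fun_delta m p (F : 'cV[R]_n -> 'M[R]_(m, p)) :
  F = \sum_i \sum_j (fun y => F y i j *: delta_mx i j).
Proof.
apply/funext => y; rewrite [LHS]matrix_sum_delta fct_sumE.
by apply: eq_bigr => i _; rewrite fct_sumE.
Qed.

Lemma differentiable_mxP m p (F : 'cV[R]_n -> 'M[R]_(m, p)) x :
  differentiable F x <-> forall i j, differentiable (fun y => F y i j) x.
Proof.
split=> [dF i j|dF].
  exact: (differentiable_comp dF (differentiable_coord _ i j)).
rewrite (mx_fun_delta F).
apply: differentiable_sum => i; apply: differentiable_sum => j.
exact: differentiableZl.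
Qed.

Lemma continuous_mxP m p (F : 'cV[R]_n -> 'M[R]_(m, p)) x :
  {for x, continuous F} <-> forall i j, {for x, continuous (fun y => F y i j)}.
Proof.
split=> [cF i j|cF].
  exact: (continuous_comp cF (@coord_continuous _ _ _ i j _)).
rewrite (mx_fun_delta F).
elim/big_ind: _ => [|f g cf cg|i _]; first exact: cst_continuous.
  exact: continuousD cf cg.
elim/big_ind: _ => [|f g cf cg|j _]; first exact: cst_continuous.
  exact: continuousD cf cg.
exact: continuousZr_tmp (cF i j).
Qed.

Lemma Ck_on_mxP k m p (F : 'cV[R]_n -> 'M[R]_(m, p)) :
  Ck_on k U F <-> forall i j, Ck_on k U (fun y => F y i j).
Proof.
elim: k F => [|k IH] F.
  split=> [cF i j x Ux|cF x Ux]; first by have /continuous_mxP := cF x Ux.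
  by apply/continuous_mxP => i j; exact: cF.
have DE v i j : (forall x, U x -> differentiable F x) ->
    {in U, (fun x => 'D_v F x i j) =1 (fun x => 'D_v (fun y => F y i j) x)}.
  move=> dF x; rewrite inE => Ux.
  by rewrite (derive_mx (diff_derivable (dF x Ux))) mxE.
split=> [[dF DF] i j|CF].
  split=> [x Ux|v]; first exact: (differentiable_mxP F x).1 (dF x Ux) i j.
  exact: eq_Ck_on (DE v i j dF) ((IH _).1 (DF v) i j).
have dF x : U x -> differentiable F x.
  by move=> Ux; apply/differentiable_mxP => i j; exact: (CF i j).1.
split=> // v; apply/IH => i j.
by apply: eq_Ck_on ((CF i j).2 v) => x Ux; rewrite DE.
Qed.

Lemma Ck_on_mulmx k m p q (F : 'cV[R]_n -> 'M[R]_(m, p)) (G : 'cV[R]_n -> 'M[R]_(p, q)) :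
  Ck_on k U F -> Ck_on k U G -> Ck_on k U (fun y => F y *m G y).
Proof.
move=> /Ck_on_mxP CF /Ck_on_mxP CG; apply/Ck_on_mxP => i j.
under eq_fun do rewrite mxE.
by apply: Ck_on_sum => l; exact: Ck_onM.
Qed.

Lemma Ck_onZ k m p a (F : 'cV[R]_n -> 'M[R]_(m, p)) :
  Ck_on k U F -> Ck_on k U (fun y => a *: F y).
Proof.
move=> /Ck_on_mxP CF; apply/Ck_on_mxP => i j; under eq_fun do rewrite mxE.
exact: Ck_onM (Ck_on_cst k a) (CF i j).
Qed.

Lemma Ck_on_det k m (F : 'cV[R]_n -> 'M[R]_m) :
  Ck_on k U F -> Ck_on k U (fun y => \det (F y)).
Proof.
move=> /Ck_on_mxP CF; apply: Ck_on_sum => s.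
by apply: Ck_onM; [exact: Ck_on_cst|exact: Ck_on_prod].
Qed.

Lemma Ck_on_invmx k m (F : 'cV[R]_n -> 'M[R]_m) : (forall x, U x -> F x \in unitmx) ->
  Ck_on k U F -> Ck_on k U (fun y => invmx (F y)).
Proof.
(* Cramer's rule reduces the inverse to determinants and one scalar inverse. *)
move=> unitF CF; have FE : {in U, (fun y => (\det (F y))^-1 *: \adj (F y)) =1
    (fun y => invmx (F y))}.
  by move=> y; rewrite inE => Uy; rewrite /invmx unitF.
apply: eq_Ck_on FE _; apply/Ck_on_mxP => i j; under eq_fun do rewrite !mxE.
apply: Ck_onM.
  apply: Ck_onV; last exact: Ck_on_det.
  by move=> x /unitF; rewrite unitmxE unitfE.
apply: Ck_onM; first exact: Ck_on_cst.
apply: Ck_on_det; apply/Ck_on_mxP => a b; under eq_fun do rewrite !mxE.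
by move/Ck_on_mxP: CF.
Qed.
End SmoothFunctions.

(** * The 1-jet of a Hermitian structure at a point of a chart *)

Section TotalDerivative.
Variables (R : realType) (n : nat).
Local Notation C := R[i].
Implicit Types (w : 'cV[C]_n) (x : 'cV[R]_n).

(* This is [cdmx w F x] at points of differentiability, but is linear in [w]
   unconditionally. *)
Definition tdmx m p (F : 'cV[R]_n -> 'M[C]_(m, p)) x w : 'M[C]_(m, p) :=
  \sum_k w k 0 *: cdmx (delta_mx k 0) F x.

Lemma tdmx_linear m p (F : 'cV[R]_n -> 'M[C]_(m, p)) x : linear (tdmx F x).
Proof.
move=> a w w'; rewrite /tdmx scaler_sumr -big_split; apply: eq_bigr => k _ /=.
by rewrite !mxE scalerDl scalerA.
Qed.

HB.instance Definition _ m p (F : 'cV[R]_n -> 'M[C]_(m, p)) x :=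
  GRing.isLinear.Build C 'cV[C]_n 'M[C]_(m, p) _ (tdmx F x) (tdmx_linear F x).

Lemma tdmxE m p (F : 'cV[R]_n -> 'M[C]_(m, p)) x w :
  cdiffmx F x -> tdmx F x w = cdmx w F x.
Proof.
move=> dF; pose linM := GRing.isLinear.Build C 'cV[C]_n 'M[C]_(m, p) _
  (fun w => cdmx w F x) (cdmx_linear dF).
pose L : {linear 'cV[C]_n -> 'M[C]_(m, p)} := HB.pack (fun w => cdmx w F x) linM.
have -> : w = \sum_k w k 0 *: delta_mx k 0.
  by rewrite [LHS]matrix_sum_delta; apply: eq_bigr => i _; rewrite big_ord1.
rewrite -[RHS]/(L _) linear_sum linear_sum; apply: eq_bigr => k _ /=.
rewrite !linearZ /= /tdmx (bigD1 k) //= big1 ?addr0 => [|i ik].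
  by rewrite mxE !eqxx /= scale1r -[RHS]/(L _) linearZ.
by rewrite mxE (negbTE ik) scale0r.
Qed.

Lemma cplxM m p q (A : 'M[R]_(m, p)) (B : 'M[R]_(p, q)) :
  cplx (A *m B) = cplx A *m cplx B.
Proof. exact: map_mxM. Qed.

Lemma cplx1 m : cplx (1%:M : 'M[R]_m) = 1%:M.
Proof. exact: map_mx1. Qed.

Lemma cplxN m p (A : 'M[R]_(m, p)) : cplx (- A) = - cplx A.
Proof. by apply/matrixP => i j; rewrite !mxE rmorphN. Qed.

Lemma cplxD m p (A B : 'M[R]_(m, p)) : cplx (A + B) = cplx A + cplx B.
Proof. by apply/matrixP => i j; rewrite !mxE rmorphD. Qed.

Lemma cplx_tr m p (A : 'M[R]_(m, p)) : cplx A^T = (cplx A)^T.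
Proof. by apply/matrixP => i j; rewrite !mxE. Qed.

Lemma cplx_nijenhuis m p (a : 'M[R]_m) (d1 d2 d3 d4 : 'M[R]_(m, p)) :
  d1 - d2 - a *m (- d3) - a *m d4 = 0 ->
  cplx d1 - cplx d2 + cplx a *m cplx d3 - cplx a *m cplx d4 = 0.
Proof.
move=> /(congr1 (@cplx R _ _)); rewrite mulmxN opprK !(cplxD, cplxN, cplxM) => ->.
exact: map_mx0.
Qed.

Lemma sqr_ii : ii R * ii R = -1.
Proof. by rewrite -expr2 sqr_i. Qed.

Lemma two_neq0 : 2 != 0 :> C.
Proof. by rewrite pnatr_eq0. Qed.

Variable U : set 'cV[R]_n.
Hypothesis oU : open U.

Lemma smooth_differentiable m p (F : 'cV[R]_n -> 'M[R]_(m, p)) x :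
  smooth_on U F -> U x -> differentiable F x.
Proof. by move=> /(_ 1)[dF _] Ux; exact: dF. Qed.

Lemma smooth_cdiff m p (F : 'cV[R]_n -> 'M[R]_(m, p)) x :
  smooth_on U F -> U x -> cdiffmx (fun y => cplx (F y)) x.
Proof. by move=> sF Ux; exact: cdiffmx_cplx (smooth_differentiable sF Ux). Qed.

Lemma eq_open_cdmx m p (F G : 'cV[R]_n -> 'M[C]_(m, p)) x w :
  {in U, F =1 G} -> U x -> cdmx w F x = cdmx w G x.
Proof. by move=> FG Ux; exact: near_eq_cdmx (eq_near_open oU FG Ux). Qed.

Section Hermitian.
Variables A g : 'cV[R]_n -> 'M[R]_n.
Hypotheses (sA : smooth_on U A) (sg : smooth_on U g).
Hypothesis AA : forall x, U x -> A x *m A x = - 1%:M.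
Hypothesis nij : forall (X Y : 'cV[R]_n -> 'cV[R]_n) x,
  smooth_on U X -> smooth_on U Y -> U x -> nijenhuis A X Y x = 0.
Hypothesis g_sym : forall x, U x -> (g x)^T = g x.
Hypothesis gA : forall x, U x -> (A x)^T *m g x *m A x = g x.
Let cA y := cplx (A y).
Let cg y := cplx (g y).
Variable x : 'cV[R]_n.
Hypothesis Ux : U x.

Let dA : cdiffmx cA x. Proof. exact: smooth_cdiff. Qed.
Let dg : cdiffmx cg x. Proof. exact: smooth_cdiff. Qed.

Lemma field_AA y : U y -> cA y *m cA y = - 1%:M.
Proof. by move=> Uy; rewrite -cplxM AA // cplxN cplx1. Qed.

Lemma field_sym y : U y -> (cg y)^T = cg y.
Proof. by move=> Uy; rewrite -cplx_tr g_sym. Qed.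

Lemma field_herm y : U y -> (cA y)^T *m cg y = - (cg y *m cA y).
Proof.
move=> Uy; rewrite -[cg y in RHS]/(cplx (g y)) -(gA Uy) !cplxM cplx_tr.
by rewrite -!mulmxA field_AA // !mulmxN mulmx1 opprK.
Qed.

Lemma nijenhuis_cst (X Y : 'cV[R]_n) :
  nijenhuis_jet (cA x) (tdmx cA x) (cplx X) (cplx Y) = 0.
Proof.
rewrite /nijenhuis_jet /=; set D := tdmx cA x.
have DE v (Z : 'cV[R]_n) : cplx ('D_v (fun y => A y *m Z) x) = D (cplx v) *m cplx Z.
  rewrite -cdmx_cplx; last first.
    apply/differentiable_mxP => i j.
    have /= := (Ck_on_mulmx oU (sA 1) (Ck_on_cst oU 1 Z)).1 x Ux.
    by move/differentiable_mxP.
  have -> : (fun y => cplx (A y *m Z)) = (fun y => cA y *m cplx Z).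
    by apply/funext => y; rewrite cplxM.
  rewrite (cdmxM _ dA (cdiffmx_cst _ _)).
  by rewrite cdmx_cst mulmx0 addr0 /D tdmxE.
have sc (Z : 'cV[R]_n) : smooth_on U (fun=> Z) by move=> k; exact: Ck_on_cst.
have := nij (sc X) (sc Y) Ux; clear sc.
rewrite /nijenhuis /lie_bracket !derive_cst.
move: (DE (A x *m X) Y) (DE (A x *m Y) X) (DE Y X) (DE X Y).
move: ('D__ _ x) ('D__ _ x) ('D__ _ x) ('D__ _ x) => d1 d2 d3 d4.
rewrite !cplxM subr0 sub0r !subr0 -/(cA x); clearbody D => <- <- <- <-.
exact: cplx_nijenhuis.
Qed.

Lemma nijenhuis_complex X Y : nijenhuis_jet (cA x) (tdmx cA x) X Y = 0.
Proof.
apply: (@nijenhuis_jet_real _ _ _ _ (ii R) (fun Z => exists Z', Z = cplx Z')).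
  move=> Z; exists (cplx (re_mx Z)), (cplx (im_mx Z)).
  by split; [exact: re_im_mxE|exists (re_mx Z)|exists (im_mx Z)].
by move=> _ _ [Z ->] [Z' ->]; exact: nijenhuis_cst.
Qed.

Lemma field_jet : hermitian_jet (cA x) (cg x) (tdmx cA x) (tdmx cg x).
Proof.
have tA w : cdmx w (fun y => (cA y)^T) x = (cdmx w cA x)^T by exact: cdmx_tr.
have dAT : cdiffmx (fun y => (cA y)^T) x by exact: cdiffmx_tr.
split; [exact: field_AA|exact: field_sym|exact: field_herm| | | |].
- move=> w; rewrite /= !tdmxE //; apply/eqP; rewrite -addr_eq0 -(cdmxM w dA dA).
  rewrite (@eq_open_cdmx _ _ _ (fun=> - 1%:M)) ?cdmx_cst // => y.
  by rewrite inE => Uy; exact: field_AA.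
- move=> w; rewrite /= !tdmxE // -cdmx_tr; apply: eq_open_cdmx => // y.
  by rewrite inE => Uy; exact: field_sym.
- move=> w; rewrite /d_omega /= !tdmxE //.
  transitivity (cdmx w (fun y => (cA y)^T *m cg y) x); first by rewrite (cdmxM w dAT dg) tA.
  rewrite (@eq_open_cdmx _ _ _ (fun y => - (cg y *m cA y))) //; last first.
    by move=> y; rewrite inE => Uy; exact: field_herm.
  by rewrite (cdmxN w (cdiffmxM dg dA)) (cdmxM w dg dA).
- exact: nijenhuis_complex.
Qed.
End Hermitian.
End TotalDerivative.

(** * The operator d^c *)

Section SubsetSums.
Variables (V : nmodType) (k : nat).

Lemma sum_set_card0 (F : {set 'I_k} -> V) :
  \sum_(S : {set 'I_k} | #|S| == 0%N) F S = F (finset.set0).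
Proof. by rewrite (big_pred1 finset.set0) // => S; rewrite cards_eq0. Qed.

Lemma sum_set_cardT (F : {set 'I_k} -> V) :
  \sum_(S : {set 'I_k} | #|S| == k) F S = F (finset.setT).
Proof.
rewrite (big_pred1 finset.setT) // => S.
rewrite [RHS]finset.eqEcard finset.subsetT cardsT card_ord /= eqn_leq.
by have := max_card (mem S); rewrite card_ord => ->.
Qed.

Lemma sum_set_card1 (F : {set 'I_k} -> V) :
  \sum_(S : {set 'I_k} | #|S| == 1%N) F S = \sum_i F (finset.set1 i).
Proof.
transitivity (\sum_(S in [set finset.set1 i | i : 'I_k]%SET) F S).
  apply: eq_bigl => S; apply/cards1P/imsetP => [[i ->]|[i _ ->]]; first by exists i.
  by exists i.
by rewrite big_imset //= => i j _ _; exact: finset.set1_inj.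
Qed.

Lemma sum_set_cardC1 (F : {set 'I_k} -> V) : (0 < k)%N ->
  \sum_(S : {set 'I_k} | #|S| == k.-1) F S = \sum_i F (~: finset.set1 i)%SET.
Proof.
move=> k0; rewrite (reindex_inj (inv_inj (@finset.setCK _))) /=.
rewrite -(sum_set_card1 (fun S => F (~: S)%SET)); apply: eq_bigl => S.
have -> : #|(~: S)%SET| = (k - #|S|)%N.
  by have := cardsC S; rewrite card_ord => e; lia.
have : (#|S| <= k)%N by rewrite -[X in (_ <= X)%N]card_ord max_card.
by move=> ?; apply/idP/idP => /eqP ?; apply/eqP; lia.
Qed.
End SubsetSums.

Lemma sum_lift3 (S : pzRingType) (t : 'I_3 -> 'I_3 -> 'I_3 -> S) :
  \sum_(j < 3) (-1) ^+ j * t j (lift j 0) (lift j 1) =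
  t 0 1 ord_max - t 1 0 ord_max + t ord_max 0 1.
Proof.
have tE (a a' b b' c c' : 'I_3) : a = a' :> nat -> b = b' :> nat -> c = c' :> nat ->
    t a b c = t a' b' c' by move=> /val_inj -> /val_inj -> /val_inj ->.
rewrite !big_ord_recl big_ord0 addr0 expr0 mul1r expr1 mulN1r sqrrN expr1n mul1r addrA.
by congr (_ - _ + _); exact: tE.
Qed.

Lemma sum_select3 (S : zmodType) (V : Type) (t : V -> V -> V -> S) a a' b b' c c' :
  \sum_(i < 3) t (if 0 == i then a else a') (if 1 == i then b else b')
    (if ord_max == i then c else c') = t a b' c' + t a' b c' + t a' b' c.
Proof. by rewrite !big_ord_recl big_ord0 addr0 addrA. Qed.

Lemma bil_cross (F : fieldType) n (B : 'M[F]_n) (X X' Y Y' : 'cV[F]_n) :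
  bil B X Y = 0 -> bil B X' Y' = 0 ->
  bil B (X + X') (Y + Y') = bil B X Y' + bil B X' Y.
Proof. by move=> e e'; rewrite bilDl !bilDr e e' add0r addr0. Qed.

(** * Types of the fundamental form, and d^c of it as minus the torsion *)

Section ComplexOperator.
Variables (R : realType) (n : nat).
Local Notation C := R[i].
Implicit Types (x y : 'cV[R]_n).
Variable U : set 'cV[R]_n.
Hypothesis oU : open U.
Variables A g : 'cV[R]_n -> 'M[R]_n.
Hypotheses (sA : smooth_on U A) (sg : smooth_on U g).
Hypothesis AA : forall x, U x -> A x *m A x = - 1%:M.
Hypothesis nij : forall (X Y : 'cV[R]_n -> 'cV[R]_n) x,
  smooth_on U X -> smooth_on U Y -> U x -> nijenhuis A X Y x = 0.
Hypothesis g_sym : forall x, U x -> (g x)^T = g x.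
Hypothesis gA : forall x, U x -> (A x)^T *m g x *m A x = g x.
Let cA y := cplx (A y).
Let cg y := cplx (g y).

Lemma pi10_mul y (v : 'cV[C]_n) :
  pi10 (A y) *m v = 2^-1 *: (v + (- ii R) *: (cA y *m v)).
Proof. by rewrite /pi10 -scalemxAl mulmxBl mul1mx -scalemxAl scaleNr. Qed.

Lemma pi01_mul y (v : 'cV[C]_n) :
  pi01 (A y) *m v = 2^-1 *: (v + ii R *: (cA y *m v)).
Proof. by rewrite /pi01 -scalemxAl mulmxDl mul1mx -scalemxAl. Qed.

Lemma pi10_eigen y (v : 'cV[C]_n) : U y ->
  cA y *m (pi10 (A y) *m v) = ii R *: (pi10 (A y) *m v).
Proof.
move=> Uy; rewrite pi10_mul -!scalemxAr mulmxDr -scalemxAr mulmxA (field_AA AA Uy).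
rewrite mulNmx mul1mx [RHS]scalerA [ii R * _]mulrC -[RHS]scalerA; congr (_ *: _).
by rewrite scalerN !scaleNr opprK scalerBr scalerA sqr_ii scaleN1r opprK addrC.
Qed.

Lemma pi01_eigen y (v : 'cV[C]_n) : U y ->
  cA y *m (pi01 (A y) *m v) = - ii R *: (pi01 (A y) *m v).
Proof.
move=> Uy; rewrite pi01_mul -!scalemxAr mulmxDr -scalemxAr mulmxA (field_AA AA Uy).
rewrite mulNmx mul1mx [RHS]scalerA [- ii R * _]mulrC -[RHS]scalerA; congr (_ *: _).
by rewrite scalerDr scalerA mulNr sqr_ii opprK scale1r scalerN scaleNr addrC.
Qed.

Lemma pi10D01 y (v : 'cV[C]_n) : pi10 (A y) *m v + pi01 (A y) *m v = v.
Proof.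
rewrite pi10_mul pi01_mul -scalerDr addrACA -scalerDl addNr scale0r addr0.
have -> : v + v = (2 : C) *: v by rewrite scaler_nat mulr2n.
by rewrite scalerA mulVf ?scale1r // two_neq0.
Qed.

Let om : Defs.form R n 2 := fun y v => bil (cplx ((A y)^T *m g y)) (v 0) (v 1).

Lemma omE y (X Y : 'cV[C]_n) : U y ->
  bil (cplx ((A y)^T *m g y)) X Y = bil (cg y) (cA y *m X) Y.
Proof. by move=> Uy; rewrite cplxM cplx_tr bil_mull. Qed.

Lemma om_eigen y (s : C) (X Y : 'cV[C]_n) : U y -> s * s = -1 ->
  cA y *m X = s *: X -> cA y *m Y = s *: Y ->
  bil (cplx ((A y)^T *m g y)) X Y = 0.
Proof.
move=> Uy ss AX AY; rewrite omE // AX bilZl (_ : bil _ X Y = 0) ?mulr0 //.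
have : bil (cg y) (cA y *m X) Y = - bil (cg y) X (cA y *m Y).
  by rewrite -bil_mull (field_herm AA gA Uy) bilN bil_mulr.
rewrite AX AY bilZl bilZr => /eqP.
rewrite -subr_eq0 opprK -mulr2n -mulr_natl !mulf_eq0 (negbTE (two_neq0 R)) /=.
case/orP => /eqP // s0; move: ss; rewrite s0 mul0r => /eqP.
by rewrite eq_sym oppr_eq0 oner_eq0.
Qed.

Lemma type_comp_om0 y v : U y -> type_comp A 0 om y v = 0.
Proof.
move=> Uy; rewrite /type_comp sum_set_card0 /om !finset.in_set0.
by apply: (@om_eigen y (- ii R)); rewrite ?mulrNN ?sqr_ii //; exact: pi01_eigen.
Qed.

Lemma type_comp_om2 y v : U y -> type_comp A 2 om y v = 0.
Proof.
move=> Uy; rewrite /type_comp sum_set_cardT /om !finset.in_setT.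
by apply: (@om_eigen y (ii R)); rewrite ?sqr_ii //; exact: pi10_eigen.
Qed.

Lemma type_comp_om1 y v : U y -> type_comp A 1 om y v = om y v.
Proof.
move=> Uy; rewrite /type_comp sum_set_card1 big_ord_recl big_ord1 /om.
rewrite !finset.in_set1 /=.
have := type_comp_om0 v Uy; have := type_comp_om2 v Uy.
rewrite /type_comp sum_set_card0 sum_set_cardT /om !finset.in_set0 !finset.in_setT.
move=> e2 e1; rewrite -[v 0 in RHS](pi10D01 y) -[v 1 in RHS](pi10D01 y).
by rewrite (bil_cross e2 e1).
Qed.

Lemma eq_ext_d k (w w' : Defs.form R n k) x v :
  (forall y u, U y -> w y u = w' y u) -> U x -> ext_d w x v = ext_d w' x v.
Proof.
move=> ww Ux; apply: eq_bigr => j _; congr (_ * _).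
by apply/near_eq_cderive/(eq_near_open oU _ Ux) => y; rewrite inE; exact: ww.
Qed.

Lemma ext_d_zero k (w : Defs.form R n k) x v : (forall y u, U y -> w y u = 0) ->
  U x -> ext_d w x v = 0.
Proof.
move=> w0 Ux; rewrite (eq_ext_d (w' := fun _ _ => 0)) //.
by rewrite /ext_d big1 // => j _; rewrite cderive_cst mulr0.
Qed.

Lemma type_comp_zero k p (w : Defs.form R n k) x v : (forall u, w x u = 0) ->
  type_comp A p w x v = 0.
Proof. by move=> w0; rewrite /type_comp big1. Qed.

Variable x : 'cV[R]_n.
Hypothesis Ux : U x.
Let D := d_omega (cA x) (cg x) (tdmx cA x) (tdmx cg x).
Let jetA := field_jet oU sA sg AA nij g_sym gA Ux.

Lemma cdmx_om w : cdmx w (fun y => cplx ((A y)^T *m g y)) x = D w.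
Proof.
have dA := smooth_cdiff sA Ux; have dg := smooth_cdiff sg Ux.
have -> : (fun y => cplx ((A y)^T *m g y)) = (fun y => (cA y)^T *m cg y).
  by apply/funext => y; rewrite cplxM cplx_tr.
by rewrite (cdmxM w (cdiffmx_tr dA) dg) cdmx_tr /D /d_omega /= !tdmxE.
Qed.

Lemma cdiff_om : cdiffmx (fun y => cplx ((A y)^T *m g y)) x.
Proof.
have dA := smooth_cdiff sA Ux; have dg := smooth_cdiff sg Ux.
have -> : (fun y => cplx ((A y)^T *m g y)) = (fun y => (cA y)^T *m cg y).
  by apply/funext => y; rewrite cplxM cplx_tr.
exact: cdiffmxM (cdiffmx_tr dA) dg.
Qed.

Lemma ext_d_om v : ext_d om x v = cyc3 D (v 0) (v 1) (v ord_max).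
Proof.
have cE w X Y : cderive w (fun y => bil (cplx ((A y)^T *m g y)) X Y) x = bil (D w) X Y.
  by rewrite /bil (cderive_mulmx _ _ _ cdiff_om) cdmx_om.
have -> : ext_d om x v =
    \sum_(j < 3) (-1) ^+ j * bil (D (v j)) (v (lift j 0)) (v (lift j 1)).
  by apply: eq_bigr => j _; rewrite -cE.
have alt X Y Z : bil (D X) Y Z = - bil (D X) Z Y.
  by rewrite -bil_tr (d_omega_alt jetA) bilN.
rewrite (sum_lift3 (fun i j k => bil (D (v i)) (v j) (v k))) /cyc3.
by clearbody D; rewrite (alt (v 1)) opprK.
Qed.

Lemma dc_torsion v : dc A om x v =
  - torsion (cA x) (cg x) (tdmx cA x) (tdmx cg x) (v 0) (v 1) (v ord_max).
Proof.
(* The fundamental form has type (1, 1), so only the index p = 1 survives: [del] and [delbar] become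
   the components of type (2, 1) and (1, 2) of its differential. *)
have z (p : 'I_3) q u : p != 1 -> type_comp A q (ext_d (type_comp A p om)) x u = 0.
  move=> p1; apply: type_comp_zero => u'; apply: ext_d_zero Ux => y w Uy.
  case: p p1 => [[|[|[|]]]] // ? _; first exact: type_comp_om0.
  exact: type_comp_om2.
have z1 u : ext_d (type_comp A 1 om) x u = cyc3 D (u 0) (u 1) (u ord_max).
  by rewrite -ext_d_om; apply: eq_ext_d Ux => y w; exact: type_comp_om1.
have E q u : \sum_(p < 3) type_comp A (q p) (ext_d (type_comp A p om)) x u
    = type_comp A (q 1) (ext_d (type_comp A 1 om)) x u.
  by rewrite (bigD1 1) // big1 => [|p p1]; [exact: addr0|exact: z].
have dE : del A om x v = type_comp A 2 (ext_d (type_comp A 1 om)) x v.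
  exact: (E (fun p : 'I_3 => p.+1) v).
have dbE : delbar A om x v = type_comp A 1 (ext_d (type_comp A 1 om)) x v.
  exact: (E (fun p : 'I_3 => nat_of_ord p) v).
rewrite /dc dE dbE.
set a := pi10 (A x) *m v 0; set a' := pi01 (A x) *m v 0.
set b := pi10 (A x) *m v 1; set b' := pi01 (A x) *m v 1.
set c := pi10 (A x) *m v ord_max; set c' := pi01 (A x) *m v ord_max.
have -> : type_comp A 1 (ext_d (type_comp A 1 om)) x v =
    cyc3 D a b' c' + cyc3 D a' b c' + cyc3 D a' b' c.
  rewrite /type_comp sum_set_card1 -(sum_select3 (cyc3 D) a a' b b' c c').
  apply: eq_bigr => i _; rewrite z1 !finset.in_set1.
  by case: (0 == i); case: (1 == i); case: (ord_max == i).
have -> : type_comp A 2 (ext_d (type_comp A 1 om)) x v =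
    cyc3 D a' b c + cyc3 D a b' c + cyc3 D a b c'.
  (* Pairs of slots are complements of singletons, so the sum for type (1, 2) is reused with the two
     projections exchanged. *)
  rewrite /type_comp (@sum_set_cardC1 _ 3) //.
  rewrite -(sum_select3 (cyc3 D) a' a b' b c' c); apply: eq_bigr => i _.
  rewrite z1 !finset.in_setC !finset.in_set1.
  by case: (0 == i); case: (1 == i); case: (ord_max == i).
rewrite /a /a' /b /b' /c /c' (pi10_mul x (v 0)) (pi10_mul x (v 1)).
rewrite (pi10_mul x (v ord_max)) (pi01_mul x (v 0)) (pi01_mul x (v 1)).
rewrite (pi01_mul x (v ord_max)).
exact: (@trilinear_types _ _ (mulmx (cA x)) _ (two_neq0 R) (sqr_ii R) (hj_AA jetA) _
  (cyc3_trilinear (d_omega_linear (cA x) (cg x) (tdmx cA x) (tdmx cg x)))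
  (hj_type jetA)).
Qed.
End ComplexOperator.

(** * The equivalence at a point of a chart *)

Section Conjugation.
Variables (R : realType) (n : nat).
Local Notation C := R[i].

Lemma cconj_mxM m p q (M : 'M[C]_(m, p)) (N : 'M[C]_(p, q)) :
  cconj_mx (M *m N) = cconj_mx M *m cconj_mx N.
Proof. exact: map_mxM. Qed.

Lemma cconj_mx_tr m p (M : 'M[C]_(m, p)) : cconj_mx M^T = (cconj_mx M)^T.
Proof. by apply/matrixP => i j; rewrite !mxE. Qed.

Lemma cconj_mxD m p (M N : 'M[C]_(m, p)) : cconj_mx (M + N) = cconj_mx M + cconj_mx N.
Proof. by apply/matrixP => i j; rewrite !mxE rmorphD. Qed.

Lemma cconj_mxZ m p a (M : 'M[C]_(m, p)) : cconj_mx (a *: M) = conjc a *: cconj_mx M.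
Proof. by apply/matrixP => i j; rewrite !mxE rmorphM. Qed.

Lemma cconj_mxK m p (M : 'M[C]_(m, p)) : cconj_mx (cconj_mx M) = M.
Proof. by apply/matrixP => i j; rewrite !mxE conjcK. Qed.

Lemma cconj_mx_cplx m p (M : 'M[R]_(m, p)) : cconj_mx (cplx M) = cplx M.
Proof. by apply/matrixP => i j; rewrite !mxE; exact: conjc_real. Qed.

Lemma bil_conj (B : 'M[C]_n) (X Y : 'cV[C]_n) :
  bil (cconj_mx B) (cconj_mx X) (cconj_mx Y) = conjc (bil B X Y).
Proof. by rewrite /bil -cconj_mx_tr -!cconj_mxM [LHS]mxE. Qed.

Lemma cyc3_conj (D : 'cV[C]_n -> 'M[C]_n) X Y Z :
  (forall X, D (cconj_mx X) = cconj_mx (D X)) ->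
  cyc3 D (cconj_mx X) (cconj_mx Y) (cconj_mx Z) = conjc (cyc3 D X Y Z).
Proof. by move=> DE; rewrite /cyc3 !DE !bil_conj !rmorphD. Qed.

Lemma conjcDM (a b c : C) : conjc (a + b * c) = conjc a + conjc b * conjc c.
Proof. by rewrite rmorphD rmorphM. Qed.

(** omega_J and omega_K are real, so conjugating passes from s = i on T^{1,0} to s = - i on
    T^{0,1}. *)
Lemma theta_cconj (J K g : 'M[C]_n) (dJ dK dg : {linear 'cV[C]_n -> 'M[C]_n}) s X Y Z :
  (forall X, d_omega J g dJ dg (cconj_mx X) = cconj_mx (d_omega J g dJ dg X)) ->
  (forall X, d_omega K g dK dg (cconj_mx X) = cconj_mx (d_omega K g dK dg X)) ->
  theta J K g dJ dK dg (conjc s) (cconj_mx X) (cconj_mx Y) (cconj_mx Z) =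
  conjc (theta J K g dJ dK dg s X Y Z).
Proof.
move=> EJ EK; rewrite /theta conjcDM.
by congr (_ + _ * _); [exact: cyc3_conj EJ|exact: cyc3_conj EK].
Qed.

Lemma conjcN_ii : conjc (- ii R) = ii R.
Proof. by apply: complex_eq => /=; rewrite ?oppr0 ?opprK. Qed.

Lemma conjc_ii : conjc (ii R) = - ii R.
Proof. by apply: complex_eq => /=; rewrite ?oppr0. Qed.
End Conjugation.

Section LocalEquivalence.
Variables (R : realType) (n : nat).
Local Notation C := R[i].
Variable U : set 'cV[R]_n.
Hypothesis oU : open U.
Variables I J K g : 'cV[R]_n -> 'M[R]_n.
Hypotheses (sI : smooth_on U I) (sJ : smooth_on U J) (sK : smooth_on U K).
Hypothesis sg : smooth_on U g.
Hypothesis II : forall x, U x -> I x *m I x = - 1%:M.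
Hypothesis JJ : forall x, U x -> J x *m J x = - 1%:M.
Hypothesis KK : forall x, U x -> K x *m K x = - 1%:M.
Hypothesis nI : forall (X Y : 'cV[R]_n -> 'cV[R]_n) x,
  smooth_on U X -> smooth_on U Y -> U x -> nijenhuis I X Y x = 0.
Hypothesis nJ : forall (X Y : 'cV[R]_n -> 'cV[R]_n) x,
  smooth_on U X -> smooth_on U Y -> U x -> nijenhuis J X Y x = 0.
Hypothesis nK : forall (X Y : 'cV[R]_n -> 'cV[R]_n) x,
  smooth_on U X -> smooth_on U Y -> U x -> nijenhuis K X Y x = 0.
Hypothesis IJ : forall x, U x -> I x *m J x = K x.
Hypothesis JI : forall x, U x -> J x *m I x = - K x.
Hypothesis g_sym : forall x, U x -> (g x)^T = g x.
Hypothesis g_unit : forall x, U x -> g x \in unitmx.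
Hypothesis gI : forall x, U x -> (I x)^T *m g x *m I x = g x.
Hypothesis gJ : forall x, U x -> (J x)^T *m g x *m J x = g x.
Hypothesis gK : forall x, U x -> (K x)^T *m g x *m K x = g x.
Let cI y := cplx (I y).
Let cJ y := cplx (J y).
Let cK y := cplx (K y).
Let cg y := cplx (g y).
Let ch y := cplx (invmx (g y)).

Let cIJ y : U y -> cI y *m cJ y = cK y.
Proof. by move=> Uy; rewrite -cplxM IJ. Qed.
Let cJI y : U y -> cJ y *m cI y = - cK y.
Proof. by move=> Uy; rewrite -cplxM JI // cplxN. Qed.
Let cJK y : U y -> cJ y *m cK y = cI y.
Proof.
move=> Uy; rewrite -(cIJ Uy) mulmxA (cJI Uy) -(cIJ Uy) mulNmx -mulmxA.
by rewrite (field_AA JJ Uy) mulmxN opprK mulmx1.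
Qed.
Let chg y : U y -> ch y *m cg y = 1%:M.
Proof. by move=> Uy; rewrite -cplxM mulVmx ?g_unit // cplx1. Qed.

Let Om y := (cJ y)^T *m cg y + ii R *: ((cK y)^T *m cg y).
Let p y := 2^-1 *: (1%:M - ii R *: cI y).

Definition Poisson_mx y := - 4^-1 *: ((cJ y - ii R *: cK y) *m ch y).

Let two := two_neq0 R.
Let ss := sqr_ii R.
Let fI y (Uy : U y) := field_AA II Uy.
Let fJ y (Uy : U y) := field_AA JJ Uy.
Let hI y (Uy : U y) := field_herm II gI Uy.
Let hJ y (Uy : U y) := field_herm JJ gJ Uy.
Let hK y (Uy : U y) := field_herm KK gK Uy.
Let gs y (Uy : U y) := field_sym g_sym Uy.

Lemma Poisson_mx_alt y : U y -> (Poisson_mx y)^T = - Poisson_mx y.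
Proof. by move=> Uy; apply: (P_alt _ (hJ Uy) (hK Uy) (gs Uy) (chg Uy)). Qed.

Lemma Omega_Poisson y : U y -> Om y *m Poisson_mx y = - (p y)^T.
Proof.
by move=> Uy; apply: (Omega_P two ss (fI Uy) (fJ Uy) (cIJ Uy) (cJI Uy) (hI Uy) (hJ Uy)
  (hK Uy) (chg Uy)).
Qed.
Lemma Poisson_p y : U y -> Poisson_mx y *m (p y)^T = Poisson_mx y.
Proof.
by move=> Uy; apply: (P_p two ss (fI Uy) (cIJ Uy) (hJ Uy) (hK Uy) (gs Uy) (chg Uy)).
Qed.

Lemma Poisson_Omega y : U y -> Poisson_mx y *m Om y = - p y.
Proof.
by move=> Uy; apply: (P_Omega two ss (fI Uy) (fJ Uy) (cIJ Uy) (cJI Uy) (hI Uy) (hJ Uy)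
  (hK Uy) (gs Uy) (chg Uy)).
Qed.

Lemma smooth_invmx : smooth_on U (fun y => invmx (g y)).
Proof. by move=> k; apply: Ck_on_invmx. Qed.

Variable x : 'cV[R]_n.
Hypothesis Ux : U x.

Let dcI : cdiffmx cI x := smooth_cdiff sI Ux.
Let dcJ : cdiffmx cJ x := smooth_cdiff sJ Ux.
Let dcK : cdiffmx cK x := smooth_cdiff sK Ux.
Let dcg : cdiffmx cg x := smooth_cdiff sg Ux.
Let dch : cdiffmx ch x := smooth_cdiff smooth_invmx Ux.
Let jI := field_jet oU sI sg II nI g_sym gI Ux.
Let jJ := field_jet oU sJ sg JJ nJ g_sym gJ Ux.
Let jK := field_jet oU sK sg KK nK g_sym gK Ux.

Let dJK X : tdmx cJ x X *m cK x + cJ x *m tdmx cK x X = tdmx cI x X.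
Proof.
rewrite !tdmxE // -(cdmxM X dcJ dcK); apply: (eq_open_cdmx oU X _ Ux) => y.
by rewrite inE; exact: cJK.
Qed.

Let dJI X : tdmx cJ x X *m cI x + cJ x *m tdmx cI x X = - tdmx cK x X.
Proof.
rewrite !tdmxE // -(cdmxM X dcJ dcI) -(cdmxN X dcK); apply: (eq_open_cdmx oU X _ Ux) => y.
by rewrite inE; exact: cJI.
Qed.

Let dcOm : cdiffmx Om x.
Proof.
apply: cdiffmxD; first exact: cdiffmxM (cdiffmx_tr dcJ) dcg.
exact/cdiffmxZ/(cdiffmxM (cdiffmx_tr dcK) dcg).
Qed.

Let dcp : cdiffmx p x.
Proof.
apply/cdiffmxZ/cdiffmxD; first exact: cdiffmx_cst.
exact/cdiffmxN/cdiffmxZ.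
Qed.

Let dcP : cdiffmx Poisson_mx x.
Proof.
apply/cdiffmxZ/(cdiffmxM _ dch); apply: cdiffmxD => //.
exact/cdiffmxN/cdiffmxZ.
Qed.

Let OJ := d_omega (cJ x) (cg x) (tdmx cJ x) (tdmx cg x).
Let OK := d_omega (cK x) (cg x) (tdmx cK x) (tdmx cg x).

Let dOmE X : cdmx X Om x = OJ X + ii R *: OK X.
Proof.
have dJg := cdiffmxM (cdiffmx_tr dcJ) dcg; have dKg := cdiffmxM (cdiffmx_tr dcK) dcg.
rewrite (cdmxD X dJg (cdiffmxZ _ dKg)) (cdmxZ X _ dKg).
rewrite (cdmxM X (cdiffmx_tr dcJ) dcg) (cdmxM X (cdiffmx_tr dcK) dcg) !cdmx_tr.
by rewrite /OJ /OK /d_omega /= !tdmxE.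
Qed.

Let dpE X : cdmx X p x = - (2^-1 * ii R) *: tdmx cI x X.
Proof.
have d1 : cdiffmx (fun=> 1%:M : 'M[C]_n) x by exact: cdiffmx_cst.
have dN := cdiffmxN (cdiffmxZ (ii R) dcI).
rewrite (cdmxZ X _ (cdiffmxD d1 dN)) (cdmxD X d1 dN) cdmx_cst add0r.
rewrite (cdmxN X (cdiffmxZ _ dcI)) (cdmxZ X _ dcI) tdmxE //.
by rewrite scalerN scalerA scaleNr.
Qed.

Lemma Poisson_range (a : 'rV[C]_n) :
  cI x *m (a *m Poisson_mx x)^T = ii R *: (a *m Poisson_mx x)^T.
Proof.
rewrite trmx_mul (Poisson_mx_alt Ux) mulNmx mulmxN mulmxA.
by rewrite (I_P _ ss (fI Ux) (cIJ Ux)) -scalemxAl scalerN.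
Qed.

(** The covector - i_X Omega is a preimage of X because Omega P = - p^T and p fixes X. Hence testing
    the bracket on all covectors tests dOmega on all of T^{1,0}. *)
Lemma Poisson_onto (X : 'cV[C]_n) : cI x *m X = ii R *: X ->
  (- (X^T *m Om x) *m Poisson_mx x)^T = X.
Proof.
move=> IX; rewrite mulNmx -mulmxA (Omega_Poisson Ux) mulmxN opprK trmx_mul !trmxK.
rewrite /p -scalemxAl mulmxBl mul1mx -scalemxAl IX scalerA ss scaleN1r opprK.
have -> : X + X = (2 : C) *: X by rewrite scaler_nat mulr2n.
by rewrite scalerA mulVf // scale1r.
Qed.

(** The factor 2 appears because [schouten P P] counts each term twice. Agreement on the open set
    [U] suffices to differentiate at [x]; off the chart [P_of] takes unspecified values. *)
Lemma schouten_theta (P : 'cV[R]_n -> 'M[C]_n) a b e : {in U, P =1 Poisson_mx} ->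
  schouten P P x a b e = - 2 * theta (cJ x) (cK x) (cg x) (tdmx cJ x) (tdmx cK x)
    (tdmx cg x) (ii R) (a *m Poisson_mx x)^T (b *m Poisson_mx x)^T
    (e *m Poisson_mx x)^T.
Proof.
move=> PE; have Px : P x = Poisson_mx x by rewrite PE ?inE.
have term X (v w : 'rV[C]_n) : cderive X (fun y => (v *m P y *m w^T) 0 0) x =
    (v *m cdmx X Poisson_mx x *m w^T) 0 0.
  rewrite -(cderive_mulmx X v w^T dcP); apply/near_eq_cderive/(eq_near_open oU _ Ux).
  by move=> y Uy; rewrite PE.
have dPOm X : cdmx X Poisson_mx x *m Om x + Poisson_mx x *m cdmx X Om x = - cdmx X p x.
  rewrite -(cdmxM X dcP dcOm) -(cdmxN X dcp); apply: (eq_open_cdmx oU X _ Ux) => y.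
  by rewrite inE; exact: Poisson_Omega.
have dPp X : cdmx X Poisson_mx x *m (p x)^T + Poisson_mx x *m (cdmx X p x)^T =
    cdmx X Poisson_mx x.
  rewrite -(cdmx_tr X p) -(cdmxM X dcP (cdiffmx_tr dcp)).
  by apply: (eq_open_cdmx oU X _ Ux) => y; rewrite inE; exact: Poisson_p.
have dp_sym10 X Y : cI x *m X = ii R *: X -> cI x *m Y = ii R *: Y ->
    cdmx X p x *m Y = cdmx Y p x *m X.
  move=> IX IY; rewrite !dpE -!scalemxAl; congr (_ *: _).
  by apply: (hj_eigen_sym jI two ss _ IX IY); left.
have dp_sym u v : cdmx (u *m Poisson_mx x)^T p x *m (v *m Poisson_mx x)^T =
    cdmx (v *m Poisson_mx x)^T p x *m (u *m Poisson_mx x)^T.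
  exact: dp_sym10 (Poisson_range u) (Poisson_range v).
have := schouten_dOm (Poisson_mx_alt Ux) (Omega_Poisson Ux) dPOm dPp dp_sym a b e.
rewrite /schouten !term Px /= => sE.
have -> : theta (cJ x) (cK x) (cg x) (tdmx cJ x) (tdmx cK x)
    (tdmx cg x) (ii R) (a *m Poisson_mx x)^T (b *m Poisson_mx x)^T
    (e *m Poisson_mx x)^T = cyc3 (fun X => cdmx X Om x) (a *m Poisson_mx x)^T
    (b *m Poisson_mx x)^T (e *m Poisson_mx x)^T.
  by rewrite /theta -cyc3DZ /cyc3 !dOmE.
rewrite mulNr -mulrN -{}sE.
move: (_ 0 0) (_ 0 0) (_ 0 0) => t1 t2 t3.
ring.
Qed.
Let d_omega_conj (A : 'cV[R]_n -> 'M[R]_n) X : smooth_on U A ->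
  let D := d_omega (cplx (A x)) (cg x) (tdmx (fun y => cplx (A y)) x) (tdmx cg x) in
  D (cconj_mx X) = cconj_mx (D X).
Proof.
move=> sA D; have dcA := smooth_cdiff sA Ux.
rewrite /D /d_omega /= !tdmxE // cconj_mxD !cconj_mxM !cconj_mx_tr !cconj_mx_cplx.
by rewrite -!cdmx_conj //; apply: smooth_differentiable Ux.
Qed.

Let TI := torsion (cI x) (cg x) (tdmx cI x) (tdmx cg x).
Let TJ := torsion (cJ x) (cg x) (tdmx cJ x) (tdmx cg x).
Let TK := torsion (cK x) (cg x) (tdmx cK x) (tdmx cg x).
Let th := theta (cJ x) (cK x) (cg x) (tdmx cJ x) (tdmx cK x) (tdmx cg x).

Let theta_conj X Y Z :
  th (- ii R) (cconj_mx X) (cconj_mx Y) (cconj_mx Z) = conjc (th (ii R) X Y Z).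
Proof.
rewrite -conjc_ii; apply: theta_cconj => W; exact: d_omega_conj.
Qed.

Lemma local_HKT_Poisson (P : 'cV[R]_n -> 'M[C]_n) : {in U, P =1 Poisson_mx} ->
  (forall X Y Z, TI X Y Z = TJ X Y Z /\ TJ X Y Z = TK X Y Z) <->
  (forall a b e, schouten P P x a b e = 0).
Proof.
move=> PE; split=> [T a b e|S0].
  have TJK X Y Z : TJ X Y Z = TK X Y Z by have [] := T X Y Z.
  have th0 := torsion_theta jJ (cIJ Ux) (cJI Ux) ss TJK (Poisson_range a)
    (Poisson_range b) (Poisson_range e).
  by rewrite (schouten_theta a b e PE) th0 mulr0.
have th10 X Y Z : cI x *m X = ii R *: X -> cI x *m Y = ii R *: Y ->
    cI x *m Z = ii R *: Z -> th (ii R) X Y Z = 0.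
  move=> IX IY IZ.
  have := S0 (- (X^T *m Om x)) (- (Y^T *m Om x)) (- (Z^T *m Om x)).
  rewrite (schouten_theta (- (X^T *m Om x)) (- (Y^T *m Om x)) (- (Z^T *m Om x)) PE).
  rewrite (Poisson_onto IX) (Poisson_onto IY) (Poisson_onto IZ) => /eqP.
  by rewrite mulf_eq0 oppr_eq0 (negbTE two) => /eqP.
(* The bracket gives no direct information on T^{0,1}; this case is the complex conjugate of
   [th10]. *)
have th01 X Y Z : cI x *m X = - ii R *: X -> cI x *m Y = - ii R *: Y ->
    cI x *m Z = - ii R *: Z -> th (- ii R) X Y Z = 0.
  have cE W : cI x *m W = - ii R *: W -> cI x *m cconj_mx W = ii R *: cconj_mx W.
    by move=> IW; rewrite -[cI x]cconj_mx_cplx -cconj_mxM IW cconj_mxZ conjcN_ii.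
  move=> IX IY IZ; rewrite -(cconj_mxK X) -(cconj_mxK Y) -(cconj_mxK Z) theta_conj th10 ?cE //.
  exact: conjc0.
have TJK := theta_torsion jI jJ jK (cIJ Ux) (cJI Ux) dJI two ss th10 th01.
move=> X Y Z; split; last exact: TJK.
exact: (torsion_third jI jJ jK (cIJ Ux) (cJI Ux) dJK two TJK).
Qed.
End LocalEquivalence.

(** * Globalization *)

Lemma posdef_unitmx (R : realFieldType) n (g : 'M[R]_n) :
  (forall v : 'cV[R]_n, v != 0 -> 0 < (v^T *m g *m v) 0 0) -> g \in unitmx.
Proof.
move=> gpos; rewrite unitmxE unitfE; apply/negP => /det0P[v v0 vg].
suff vt0 : v^T != 0 by have := gpos _ vt0; rewrite trmxK vg mul0mx mxE ltxx.
by apply: contraNneq v0 => vt0; rewrite -[v]trmxK vt0 trmx0.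
Qed.

Lemma forall_ord3 (V : Type) (P : V -> V -> V -> Prop) :
  (forall v : 'I_3 -> V, P (v 0) (v 1) (v ord_max)) <-> forall X Y Z, P X Y Z.
Proof.
split=> [Pv X Y Z|PV v]; last exact: PV.
exact: (Pv (fun i : 'I_3 => if i == 0 then X else if i == 1 then Y else Z)).
Qed.

Lemma re_mxDi (R : realType) m p (A B : 'M[R]_(m, p)) :
  re_mx (cplx A + ii R *: cplx B) = A.
Proof. by apply/matrixP => i j; rewrite !mxE cReD cReM /= mul0r mulr0 subr0 addr0. Qed.

Lemma im_mxDi (R : realType) m p (A B : 'M[R]_(m, p)) :
  im_mx (cplx A + ii R *: cplx B) = B.
Proof. by apply/matrixP => i j; rewrite !mxE cImD cImM /= mul0r mul1r !add0r. Qed.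

Lemma Poisson_congruence (F : fieldType) n (L J J' K K' h N : 'M[F]_n) (a s : F) :
  J' *m L = L *m J -> K' *m L = L *m K ->
  a *: ((J' - s *: K') *m (L *m h *m N)) = L *m (a *: ((J - s *: K) *m h)) *m N.
Proof.
move=> JL KL; rewrite -scalemxAr -scalemxAl !mulmxA; congr (_ *: (_ *m _ *m _)).
by rewrite mulmxBl mulmxBr -scalemxAl -scalemxAr JL KL.
Qed.

Section Manifold.
Variables (R : realType) (n : nat) (M : smoothManifold R n).
Variables (I J K g : mx_field M).
Hypothesis hyp : is_hyperhermitian I J K g.
Local Notation C := R[i].

Let hypercomplex : is_hypercomplex I J K. Proof. by case: hyp. Qed.
Let metric : is_riemannian_metric g. Proof. by case: hyp => _ []. Qed.
Let csI : is_complex_structure I. Proof. by case: hypercomplex. Qed.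
Let csJ : is_complex_structure J. Proof. by case: hypercomplex. Qed.
Let csK : is_complex_structure K. Proof. by case: hypercomplex. Qed.
Let hermI : is_hermitian I g. Proof. by case: hyp => _ [_ []]. Qed.
Let hermJ : is_hermitian J g. Proof. by case: hyp => _ [_ []]. Qed.
Let hermK : is_hermitian K g. Proof. by case: hyp => _ [_ []]. Qed.

Let g_unit c x : atlas c -> img c x -> g c x \in unitmx.
Proof.
by move=> ac cx; apply: posdef_unitmx => v v0; have [_ _ _] := metric; apply.
Qed.

Section Chart.
Variable c : chart R n M.
Hypothesis ac : atlas c.
Let U := img c.
Let oU : open U. Proof. exact: img_open. Qed.
Let sI : smooth_on U (I c). Proof. by case: csI => -[+ _] _ _; apply. Qed.
Let sJ : smooth_on U (J c). Proof. by case: csJ => -[+ _] _ _; apply. Qed.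
Let sK : smooth_on U (K c). Proof. by case: csK => -[+ _] _ _; apply. Qed.
Let sg : smooth_on U (g c). Proof. by case: metric => + _ _ _; apply. Qed.
Let II x (Ux : U x) : I c x *m I c x = - 1%:M. Proof. by case: csI => _ + _; apply. Qed.
Let JJ x (Ux : U x) : J c x *m J c x = - 1%:M. Proof. by case: csJ => _ + _; apply. Qed.
Let KK x (Ux : U x) : K c x *m K c x = - 1%:M. Proof. by case: csK => _ + _; apply. Qed.
Let nI (X Y : 'cV[R]_n -> 'cV[R]_n) x : smooth_on U X -> smooth_on U Y -> U x ->
  nijenhuis (I c) X Y x = 0.
Proof. by case: csI => _ _ + *; apply. Qed.
Let nJ (X Y : 'cV[R]_n -> 'cV[R]_n) x : smooth_on U X -> smooth_on U Y -> U x ->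
  nijenhuis (J c) X Y x = 0.
Proof. by case: csJ => _ _ + *; apply. Qed.
Let nK (X Y : 'cV[R]_n -> 'cV[R]_n) x : smooth_on U X -> smooth_on U Y -> U x ->
  nijenhuis (K c) X Y x = 0.
Proof. by case: csK => _ _ + *; apply. Qed.
Let IJ x (Ux : U x) : I c x *m J c x = K c x.
Proof. by case: hypercomplex => _ _ _ /(_ c x ac Ux)[]. Qed.
Let JI x (Ux : U x) : J c x *m I c x = - K c x.
Proof. by case: hypercomplex => _ _ _ /(_ c x ac Ux)[_ <-]; rewrite opprK. Qed.
Let g_sym x (Ux : U x) : (g c x)^T = g c x.
Proof. by case: metric => _ _ + _; apply. Qed.
Let gu x (Ux : U x) : g c x \in unitmx. Proof. exact: g_unit. Qed.
Let gI x (Ux : U x) : (I c x)^T *m g c x *m I c x = g c x. Proof. exact: hermI. Qed.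
Let gJ x (Ux : U x) : (J c x)^T *m g c x *m J c x = g c x. Proof. exact: hermJ. Qed.
Let gK x (Ux : U x) : (K c x)^T *m g c x *m K c x = g c x. Proof. exact: hermK. Qed.
Let PP := Poisson_mx (J c) (K c) (g c).

Let chg x : U x -> cplx (invmx (g c x)) *m cplx (g c x) = 1%:M.
Proof. by move=> Ux; rewrite -cplxM mulVmx ?gu // cplx1. Qed.

Let Omega_mxE x : Omega_mx J K g c x = (cplx (J c x))^T *m cplx (g c x)
  + ii R *: ((cplx (K c x))^T *m cplx (g c x)).
Proof. by rewrite /Omega_mx /omega_mx !cplxM !cplx_tr. Qed.

Let cIJ x (Ux : U x) : cplx (I c x) *m cplx (J c x) = cplx (K c x).
Proof. by rewrite -cplxM IJ. Qed.
Let cJI x (Ux : U x) : cplx (J c x) *m cplx (I c x) = - cplx (K c x).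
Proof. by rewrite -cplxM JI // cplxN. Qed.

(** [Omega_raise] shows that the set from which [xget] chooses is nonempty, so the default 0 is not
    taken by default; injectivity of Z |-> i_Z Omega on T^{1,0} shows that it has only one
    element. *)
Lemma Omega_invE x (a : 'rV[C]_n) : U x -> a *m cplx (I c x) = ii R *: a ->
  Omega_inv I J K g c x a = Omega_raise (cplx (J c x)) (cplx (invmx (g c x))) a.
Proof.
move=> Ux aI.
set S := [set Z | vec10 (I c x) Z /\ iOmega J K g c x Z = a].
have S0 : S (Omega_raise (cplx (J c x)) (cplx (invmx (g c x))) a).
  split; rewrite ?/vec10 ?/iOmega ?Omega_mxE.
    exact: (Omega_raise10 (cIJ Ux) (cJI Ux) (field_herm II gI Ux) (chg Ux) aI).
  exact: (Omega_raiseK (two_neq0 R) (sqr_ii R) (field_AA JJ Ux) (cIJ Ux) (cJI Ux)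
    (field_herm II gI Ux) (field_herm JJ gJ Ux) (field_herm KK gK Ux)
    (field_sym g_sym Ux) (chg Ux) aI).
have S1 : S (Omega_inv I J K g c x a) by apply: xgetPex; exists (Omega_raise
  (cplx (J c x)) (cplx (invmx (g c x))) a).
move: S0 S1; move: (Omega_raise _ _ _) (Omega_inv _ _ _ _ _ _ _) => Z W.
rewrite /S /vec10 /iOmega /= !Omega_mxE => -[IZ OZ] [IW OW]; apply/subr0_eq.
apply: (Omega_inj10 (two_neq0 R) (sqr_ii R) (field_AA JJ Ux) (cJI Ux)
  (field_herm JJ gJ Ux) (field_herm KK gK Ux) (field_sym g_sym Ux) (chg Ux)).
  by rewrite mulmxBr IW IZ scalerBr.
by rewrite linearB /= mulmxBl OW OZ subrr.
Qed.

Lemma P_ofE x : U x -> P_of I J K g c x = PP x.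
Proof.
move=> Ux.
have pI (u : 'rV[C]_n) : u *m pi10 (I c x) *m cplx (I c x) = ii R *: (u *m pi10 (I c x)).
  rewrite -mulmxA scalemxAr; congr (_ *m _).
  rewrite /pi10 -scalemxAl mulmxBl mul1mx -scalemxAl (field_AA II Ux).
  rewrite [RHS]scalerA [ii R * _]mulrC -[RHS]scalerA; congr (_ *: _).
  by rewrite scalerBr scalerA sqr_ii scaleN1r opprK scalerN opprK addrC.
(* With [Pp] below, this removes the (1, 0) projections of dx^i and dx^j, leaving the bare matrix
   entry. *)
have Ep : pi10 (I c x) *m PP x = PP x.
  exact: (p_P _ (two_neq0 R) (sqr_ii R) (field_AA II Ux) (cIJ Ux)).
have Pp : PP x *m (pi10 (I c x))^T = PP x.
  exact: (P_p (two_neq0 R) (sqr_ii R) (field_AA II Ux) (cIJ Ux)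
    (field_herm JJ gJ Ux) (field_herm KK gK Ux) (field_sym g_sym Ux) (chg Ux)).
apply/matrixP => i j; rewrite mxE /Omega Omega_mxE !Omega_invE //.
rewrite (Omega_raise_P (two_neq0 R) (sqr_ii R) (field_AA JJ Ux) (cIJ Ux) (cJI Ux)
    (field_herm II gI Ux) (field_herm JJ gJ Ux) (field_herm KK gK Ux)
    (field_sym g_sym Ux) (chg Ux) _ (pI _)).
rewrite -[X in _ *m X *m _]/(PP x) -(mulmxA _ _ (PP x)) Ep trmx_mul mulmxA.
rewrite -(mulmxA _ (PP x)) Pp trmx_delta -rowE -colE.
by rewrite !mxE.
Qed.

Lemma PP_re_im x : U x -> PP x = cplx (- 4^-1 *: (J c x *m invmx (g c x)))
  + ii R *: cplx (4^-1 *: (K c x *m invmx (g c x))).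
Proof.
move=> Ux.
have cplxZ a (N : 'M[R]_n) : cplx (a *: N) = real_complex R a *: cplx N.
  by apply/matrixP => i j; rewrite !mxE rmorphM.
rewrite !cplxZ !cplxM /PP /Poisson_mx mulmxBl -scalemxAl scalerBr.
rewrite rmorphN /= fmorphV rmorph_nat !scaleNr opprK !scalerA mulrC.
by [].
Qed.

Lemma csmooth_P : csmooth_on U (P_of I J K g c).
Proof.
have sh : smooth_on U (fun x => invmx (g c x)) by move=> k; apply: Ck_on_invmx.
have PRI x : U x -> re_mx (P_of I J K g c x) = - 4^-1 *: (J c x *m invmx (g c x)) /\
    im_mx (P_of I J K g c x) = 4^-1 *: (K c x *m invmx (g c x)).
  move=> Ux; rewrite P_ofE // PP_re_im //.
  by rewrite re_mxDi im_mxDi.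
split=> k.
  apply: (@eq_Ck_on _ _ _ oU _ _ (fun x => - 4^-1 *: (J c x *m invmx (g c x)))).
    by move=> x; rewrite inE => /PRI[].
  exact: (Ck_onZ oU _ (Ck_on_mulmx oU (sJ k) (sh k))).
apply: (@eq_Ck_on _ _ _ oU _ _ (fun x => 4^-1 *: (K c x *m invmx (g c x)))).
  by move=> x; rewrite inE => /PRI[].
exact: (Ck_onZ oU _ (Ck_on_mulmx oU (sK k) (sh k))).
Qed.

Lemma P_of_alt x : U x -> (P_of I J K g c x)^T = - P_of I J K g c x.
Proof.
move=> Ux; rewrite P_ofE //; exact: (P_alt _ (field_herm JJ gJ Ux) (field_herm KK gK Ux)
  (field_sym g_sym Ux) (chg Ux)).
Qed.

Lemma P_of_type x (a : 'rV[C]_n) : U x -> covec01 (I c x) a -> a *m P_of I J K g c x = 0.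
Proof.
move=> Ux aI; rewrite P_ofE //.
exact: (covec01_P _ (two_neq0 R) (sqr_ii R) (field_AA II Ux) (cIJ Ux) aI).
Qed.

Lemma chart_HKT_Poisson x : U x ->
  (forall v : 'I_3 -> 'cV[C]_n,
     dc (I c) (omega I g c) x v = dc (J c) (omega J g c) x v /\
     dc (J c) (omega J g c) x v = dc (K c) (omega K g c) x v) <->
  (forall a b e, schouten (P_of I J K g c) (P_of I J K g c) x a b e = 0).
Proof.
move=> Ux; have PE : {in U, P_of I J K g c =1 PP} by move=> y; rewrite inE; exact: P_ofE.
rewrite -(local_HKT_Poisson oU sI sJ sK sg II JJ KK nI nJ nK IJ JI g_sym gu gI gJ gK
  Ux PE).
have dI v := dc_torsion oU sI sg II nI g_sym gI Ux v.
have dJ v := dc_torsion oU sJ sg JJ nJ g_sym gJ Ux v.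
have dK v := dc_torsion oU sK sg KK nK g_sym gK Ux v.
rewrite -forall_ord3; split=> T v; have [e1 e2] := T v.
  split; apply: oppr_inj; first exact: etrans (etrans (esym (dI v)) e1) (dJ v).
  exact: etrans (etrans (esym (dJ v)) e2) (dK v).
split; first exact: etrans (dI v) (etrans (congr1 -%R e1) (esym (dJ v))).
exact: etrans (dJ v) (etrans (congr1 -%R e2) (esym (dK v))).
Qed.
Lemma P_of_formula x : U x -> P_of I J K g c x =
  - 4^-1 *: ((cplx (J c x) - ii R *: cplx (K c x)) *m cplx (invmx (g c x))).
Proof. exact: P_ofE. Qed.
End Chart.

Lemma P_of_transform c c' x : atlas c -> atlas c' -> overlap c c' x ->
  let t := transition c c' in
  P_of I J K g c' (t x) = cplx (jac t x) *m P_of I J K g c x *m (cplx (jac t x))^T.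
Proof.
move=> ac ac' o t; have [cx dx] : img c x /\ dom c' (param c x) by [].
have c'x : img c' (t x) by exact: coord_img.
set L := jac t x.
have [[[_ /(_ c c' x ac ac' o) JL] _ _] [[_ /(_ c c' x ac ac' o) KL] _ _]] := (csJ, csK).
have [_ /(_ c c' x ac ac' o) gL _ _] := metric.
rewrite -/t -/L /= in JL KL gL.
have gx := g_unit ac cx; have g'x := g_unit ac' c'x.
have hL : invmx (g c' (t x)) = L *m invmx (g c x) *m L^T.
  (* Invertibility of the Jacobian is read off from the transformation law g = L^T g' L, since g is
     invertible. *)
  have Lu : L \in unitmx.
    by move: gx; rewrite gL !unitmx_mul => /andP[].
  have LTu : L^T \in unitmx by rewrite unitmx_tr.
  have e : L *m invmx (g c x) *m L^T *m g c' (t x) = 1%:M.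
    apply: (can_inj (mulmxK Lu)); rewrite mul1mx -!mulmxA (mulmxA L^T) -gL.
    by rewrite mulVmx // mulmx1.
  by rewrite -[LHS]mul1mx -e -(mulmxA _ (g c' _)) mulmxV ?mulmx1.
rewrite (P_of_formula ac' c'x) (P_of_formula ac cx) hL !cplxM cplx_tr.
have cJL : cplx (J c' (t x)) *m cplx L = cplx L *m cplx (J c x) by rewrite -!cplxM JL.
have cKL : cplx (K c' (t x)) *m cplx L = cplx L *m cplx (K c x) by rewrite -!cplxM KL.
exact: Poisson_congruence cJL cKL.
Qed.
End Manifold.

Theorem theorem3p1 (R : realType) (n : nat) (M : smoothManifold R n)
    (I J K g : mx_field M) (hIJKg : is_hyperhermitian I J K g) :
  HKT I J K g <-> is_complex_poisson I (P_of I J K g).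
Proof.
split=> [hkt|[_ _ S0] c x v ac cx]; last first.
  by apply: ((chart_HKT_Poisson hIJKg ac cx).2 _ v) => a b e; exact: S0.
split.
- split=> [c ac|c c' x ac ac' o|c x ac cx].
  + exact: csmooth_P.
  + exact: P_of_transform.
  + exact: P_of_alt.
- by move=> c x a ac cx; exact: P_of_type.
- move=> c x a b e ac cx.
  by apply: ((chart_HKT_Poisson hIJKg ac cx).1 _ a b e) => v; exact: hkt.
Qed.
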